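(* Let $0<\alpha<n$, let $q_0>1$ satisfy $\frac1{q_0}=1-\frac{\alpha}{n}$, and let $\omega\in\mathcal{A}(1,q_0)$, where $\omega$ is a nonnegative locally integrable function on $\mathbb{R}^n$; that is, $$\sup_Q\Bigg(\frac1{|Q|}\int_Q\omega(x)^{q_0}\,dx\Bigg)^{1/q_0}\Bigg(\operatorname*{ess\,sup}_{x\in Q}\frac1{\omega(x)}\Bigg)<\infty,$$ where the supremum is over all cubes $Q$ in $\mathbb{R}^n$. Then there exist a positive constant $C$, $q_1>q_0$ and $1<p_1<\frac{n}{\alpha}$ such that $\frac1{q_1}=\frac1{p_1}-\frac{\alpha}{n}$ and, for all $f\in L^p_{\omega^p}$, $$\|\mathcal{M}_\alpha f\|_{L^q_{\omega^q}}\le C\,\|f\|_{L^p_{\omega^p}},\qquad t\in[0,1),\quad \frac1p=t+\frac{1-t}{p_1},\quad \frac1q=\frac{t}{q_0}+\frac{1-t}{q_1}.$$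
   Context: The fractional maximal function on $\mathbb{R}^n$ is $\mathcal{M}_\alpha f(x):=\sup_Q |Q|^{-1+\alpha/n}\int_Q|f(y)|\,dy$, where the supremum is taken over all cubes $Q$ with center at $x$ and $|Q|$ is the measure of $Q$. For $1\le r<\infty$, $\|f\|_{L^r_{\omega^r}}:=\big(\int_{\mathbb{R}^n}|f(x)\omega(x)|^r\,dx\big)^{1/r}$, and $L^r_{\omega^r}$ is the set of measurable functions for which this is finite. Convention: $C$ denotes a positive constant independent of the main parameters.
   Formalization: The constant C may depend on t (hence on p and q), though not on f, while q1 and p1 do not depend on t; a single C for all t in [0,1) is impossible, e.g. for ω = 1 and f the indicator of a cube, by letting t tend to 1. *)

(* Defs.v *)
From HB Require Import structures.
From mathcomp Require Import all_boot all_order all_algebra.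
From mathcomp Require Import all_classical all_reals all_analysis.
From mathcomp Require Import ess_sup_inf lra.

Set Implicit Arguments.
Unset Strict Implicit.
Unset Printing Implicit Defensive.

Import Order.TTheory GRing.Theory Num.Theory.
Import numFieldNormedType.Exports.

Local Open Scope classical_set_scope.
Local Open Scope ring_scope.
Local Open Scope ereal_scope.

(* R^n, with the product (= Borel) sigma-algebra that the library puts on
   tuples.  The component type is [measurableTypeR R] rather than [R] because
   this is the carrier of [lebesgue_measure]. *)
Notation euclidean R n := (n.-tuple (measurableTypeR R)).

(* The n-dimensional Lebesgue measure is the n-fold product of
   [lebesgue_measure]: a point mass for n = 0, and the image of
   [lebesgue_measure \x mu] under (a, v) |-> a :: v in the inductive step. *)

Section cons_measure.
Context (R : realType) (n : nat).

Definition cons_pair (z : measurableTypeR R * euclidean R n) :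
  euclidean R n.+1 := [tuple of z.1 :: z.2].

Lemma measurable_cons_pair : measurable_fun setT cons_pair.
Proof. exact: measurable_cons. Qed.

Variable mu : {sigma_finite_measure set (euclidean R n) -> \bar R}.

Definition cons_measure : set (euclidean R n.+1) -> \bar R :=
  pushforward (@lebesgue_measure R \x mu) cons_pair.

Let mpre A : measurable A -> measurable (cons_pair @^-1` A).
Proof. by move=> mA; rewrite -[X in measurable X]setTI; exact: measurable_cons_pair. Qed.

Let cons_measure0 : cons_measure set0 = 0.
Proof. by rewrite /cons_measure /pushforward preimage_set0 measure0. Qed.

Let cons_measure_ge0 A : 0 <= cons_measure A.
Proof. by rewrite /cons_measure /pushforward; exact: measure_ge0. Qed.

Let cons_measure_sigma_additive : semi_sigma_additive cons_measure.
Proof.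
move=> F mF tF mUF; rewrite /cons_measure /pushforward preimage_bigcup.
apply: measure_semi_sigma_additive.
- by move=> i; exact: mpre.
- apply/trivIsetP => i j _ _ ij; rewrite -preimage_setI.
  by move/trivIsetP : tF => ->//; rewrite preimage_set0.
- by rewrite -preimage_bigcup; exact: mpre.
Qed.

HB.instance Definition _ := isMeasure.Build _ _ _ cons_measure
  cons_measure0 cons_measure_ge0 cons_measure_sigma_additive.

Let cons_measure_sigma_finite : sigma_finite setT cons_measure.
Proof.
have /sigma_finiteP[F [FT ndF Foo]] := sigma_finiteT (@lebesgue_measure R).
have /sigma_finiteP[G [GT ndG Goo]] := sigma_finiteT mu.
pose uncons (v : euclidean R n.+1) := (thead v, [tuple of behead v]).
have consK : cancel cons_pair uncons.
  by case=> a v; rewrite /uncons /cons_pair theadE; congr pair; exact/val_inj.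
have unconsK : cancel uncons cons_pair.
  by move=> v; rewrite /uncons /cons_pair /= -tuple_eta.
have muncons : measurable_fun setT uncons.
  apply/measurable_fun_pairP; split; last exact: measurable_behead.
  exact: measurable_tnth.
exists (fun i => uncons @^-1` (F i `*` G i)).
  rewrite -preimage_bigcup; apply/seteqP; split => // v _.
  have : [set: measurableTypeR R] (thead v) by [].
  have : [set: euclidean R n] [tuple of behead v] by [].
  rewrite FT GT => -[j _ Gj] [i _ Fi]; exists (maxn i j) => //; split.
  - by move: Fi; exact/subsetPset/ndF/leq_maxl.
  - by move: Gj; exact/subsetPset/ndG/leq_maxr.
move=> i; have [mF Fi] := Foo i; have [mG Gi] := Goo i; split.
  by rewrite -[X in measurable X]setTI; apply: muncons => //; exact: measurableX.
rewrite /cons_measure /pushforward -comp_preimage.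
rewrite (_ : uncons \o cons_pair = id); last exact/funext.
rewrite preimage_id product_measure1E//.
by rewrite lte_mul_pinfty// ge0_fin_numE.
Qed.

HB.instance Definition _ := @Measure_isSigmaFinite.Build _ _ _ cons_measure
  cons_measure_sigma_finite.

End cons_measure.

Section tuple0_measure.
Context (R : realType).

Definition tuple0_measure : set (euclidean R 0) -> \bar R :=
  dirac [tuple].

HB.instance Definition _ := Measure.on tuple0_measure.

Let tuple0_measure_sigma_finite : sigma_finite setT tuple0_measure.
Proof.
exists (fun=> setT); first by rewrite bigcup_const.
by move=> _; split => //; rewrite /tuple0_measure diracT ltry.
Qed.

HB.instance Definition _ := @Measure_isSigmaFinite.Build _ _ _ tuple0_measure
  tuple0_measure_sigma_finite.

End tuple0_measure.

Fixpoint lebesgue (R : realType) (n : nat) :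
    {sigma_finite_measure set (euclidean R n) -> \bar R} :=
  match n with
  | 0 => @tuple0_measure R
  | m.+1 => cons_measure (lebesgue R m)
  end.

Section definitions.
Context (R : realType) (n : nat).
Local Notation T := (euclidean R n).
Local Notation mu := (lebesgue R n).
Implicit Types (x y : T) (r : R) (w f : T -> R) (Q : set T).

(* Closed cubes, sides parallel to the axes, side length [2 * r]. *)
Definition cube x r : set T :=
  [set y | forall i, (`|(tnth y i : R) - tnth x i| <= r)%R].

Definition cubes : set (set T) :=
  [set Q | exists x r, (0 < r)%R /\ Q = cube x r].

(* Lebesgue measurability.  The sigma-algebra on [T] being the Borel one, a
   function is Lebesgue measurable iff it is a.e. equal to a Borel function. *)
Definition lebesgue_measurable f : Prop :=
  exists2 g : T -> R, measurable_fun setT g & {ae mu, forall x, f x = g x}.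

(* Compactness is taken in ['rV[R]_n], as tuples carry no topology. *)
Definition compact_tuple (K : set T) : Prop :=
  compact [set (\row_i tnth x i : 'rV[R]_n) | x in K].

Definition locally_integrable_tuple f : Prop :=
  lebesgue_measurable f /\
  forall K, compact_tuple K -> \int[mu]_(x in K) `|f x|%:E < +oo.

Definition fractional_maximal (alpha : R) f x : \bar R :=
  ereal_sup [set mu (cube x r) `^ (-1 + alpha / n%:R)%R *
                 \int[mu]_(y in cube x r) `|f y|%:E | r in [set r | (0 < r)%R]].

(* The norm of L^r_(w^r); extended-real-valued functions are allowed since the
   maximal function may take the value +oo. *)
Definition weighted_norm w r (F : T -> \bar R) : \bar R :=
  Lnorm mu r%:E (fun x => F x * (w x)%:E).

Definition weighted_L w r : set (T -> R) :=
  [set f | lebesgue_measurable f /\ weighted_norm w r (EFin \o f) < +oo].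

(* The inverse is the one of [\bar R], so that 1 / 0 = +oo.  Extending a
   nonnegative function by 0 outside [Q] does not change its essential
   supremum over [Q], as [Q] has positive measure. *)
Definition ess_sup_inv w Q : \bar R :=
  ess_sup mu ((fun x => (w x)%:E^-1) \_ Q).

Definition muckenhoupt_A1 (q : R) w : Prop :=
  ereal_sup [set ((mu Q)^-1 * \int[mu]_(x in Q) (w x `^ q)%:E) `^ q^-1 *
                 ess_sup_inv w Q | Q in cubes] < +oo.

End definitions.

Lemma lebesgue_cube (R : realType) (n : nat) (x : euclidean R n) (r : R) :
  (0 < r)%R -> lebesgue R n (cube x r) = ((2 * r) ^+ n)%:E.
Proof.
move=> r0; elim: n x => [|n IHn] x /=.
  rewrite /tuple0_measure diracE expr0 mem_set//.
  by case.
pose xt : euclidean R n := [tuple of behead x].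
pose I (a : R) : set (measurableTypeR R) := [set` `[(a - r)%R, (a + r)%R]].
have mI a : measurable (I a) by exact: measurable_itv.
have lebI a : lebesgue_measure (I a) = (2 * r)%:E.
  rewrite lebesgue_measure_itv/= lte_fin ltrD2l gtrN//.
  by rewrite -EFinB; congr EFin; lra.
have mcube : measurable (cube xt r).
  rewrite (_ : cube xt r = \bigcap_(i in [set: 'I_n])
      ((fun y : euclidean R n => tnth y i) @^-1` I (tnth xt i))).
    apply: fin_bigcap_measurable => // i _.
    by rewrite -[X in measurable X]setTI; exact: measurable_tnth.
  apply/seteqP; split => y.
    by move=> cy i _; rewrite /I /= in_itv/= -ler_distl.
  by move=> cy i; have := cy i Logic.I; rewrite /I /= in_itv/= -ler_distl.
rewrite /cons_measure /pushforward.
rewrite (_ : _ @^-1` _ = I (thead x) `*` cube xt r).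
  by rewrite product_measure1E// IHn exprS EFinM; congr (_ * _); exact: lebI.
apply/seteqP; split => [[a v]|[a v]] /=.
  move=> c; split.
    by have := c ord0; rewrite /I /= in_itv/= -ler_distl.
  move=> i; have := c (lift ord0 i); rewrite tnthS.
  by rewrite [in X in X -> _](tuple_eta x) tnthS.
rewrite /I /= in_itv/= -ler_distl => -[ca cv] i.
have [j ->|->] := unliftP ord0 i; last exact: ca.
by rewrite tnthS [in X in is_true X](tuple_eta x) tnthS.
Qed.

(* Main.v *)
(** The averages of a function over the cells of successively finer dyadic
grids form a martingale, and both steps of the proof rest on a Burkholder type
function of this martingale and of its running maximum.

First, let [v] satisfy the A_1 condition with constant [C], let [A_k] be the
averages of [v] over the dyadic subcubes of a cube [Q], and [M_k] their running
maximum.  Then [M_k <= C A_k] and [A_(k+1) <= 2^n M_k], which for small [e]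
makes the integrals of [M_k^e (2 C A_k - M_k)] nonincreasing in [k].  As
[v <= sup_k A_k] almost everywhere, this gives the reverse Hoelder inequality
for [v], so that [v^(1+e)] satisfies the A_1 condition as well.  With
[v = w^q0] this applies to [w^q] for all [q] in [(q0, q1]], where
[q1 = q0 (1 + e)].

Second, put [v = w^q] and [G = |f| w v^(-1/p)], so that
[|f| = G v v^(alpha/n - 1)].  On a cell [P], the A_1 condition bounds [v] from
below by [v(P) / (C |P|)], and [|P|^(alpha/n - 1) int_P |f|] is at most a
constant times [v(P)^(alpha/n)] times the [v]-average of [G] over [P].  By
Jensen's inequality the q-th power of this is at most a constant times the p-th
power of the [v]-average, times a power of the norm of [f].  Doob's maximal
inequality for the measure [v dx] concludes, since every cube lies in a
comparable cell of one of [2^n] shifted grids. *)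

Require Import Defs.
From mathcomp Require Import all_boot all_order all_algebra.
From mathcomp Require Import all_classical all_reals all_analysis.
From mathcomp Require Import measurable_realfun ess_sup_inf ring lra.

Set Implicit Arguments.
Unset Strict Implicit.
Unset Printing Implicit Defensive.

Import Order.TTheory GRing.Theory Num.Theory.

Local Open Scope classical_set_scope.
Local Open Scope ring_scope.

(** * Integrals of nonnegative functions *)

Section nonneg_integral.
Context d (T : measurableType d) (R : realType).
Variable mu : {measure set T -> \bar R}.
Implicit Types (D : set T) (f g : T -> \bar R).
Import HBNNSimple.

(* No measurability is required, as the integral of a nonnegative function is
   a supremum over the simple functions below it. *)
Lemma ae_le_integral D f g :
  (forall x, D x -> (0 <= f x)%E) -> (forall x, D x -> (0 <= g x)%E) ->
  {ae mu, forall x, D x -> (f x <= g x)%E} ->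
  (\int[mu]_(x in D) f x <= \int[mu]_(x in D) g x)%E.
Proof.
move=> f0 g0 [N [mN muN fgN]]; rewrite !ge0_integralE//.
apply: ge_ereal_sup => _ [h /= hf <-]; apply: ereal_sup_ubound.
(* Setting [h] to zero on the null set [N] puts it below [g] on all of [D] and leaves its integral
   unchanged. *)
have mCN := measurableC mN.
exists (proj_nnsfun h mCN) => /=.
  move=> x; rewrite /= mindicE; case: (boolP (_ \in _)) => [|_]; last first.
    by rewrite mulr0 /patch; case: ifPn => // /set_mem /g0.
  rewrite mulr1 inE => Nx; apply: (le_trans (hf x)); rewrite /patch.
    case: ifPn => // /set_mem Dx; apply: contrapT => fg.
    by apply: Nx; apply: fgN => /= /(_ Dx).
transitivity (sintegral mu (h \_ (~` N))); first by rewrite (mrestrict h mCN).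
rewrite -integral_nnsfun////.
rewrite -[RHS]/(sintegral mu h) -[in RHS](patch_setT (fun=> 0) h).
rewrite -[RHS](integral_nnsfun mu measurableT).
rewrite [RHS](ge0_negligible_integral mN)//; last 2 first.
  exact/measurable_EFinP.
  by move=> x _; rewrite lee_fin; exact: fun_ge0.
by rewrite setTD.
Qed.

Lemma ae_eq_ge0_integral D f g :
  (forall x, D x -> (0 <= f x)%E) -> (forall x, D x -> (0 <= g x)%E) ->
  {ae mu, forall x, D x -> f x = g x} ->
  (\int[mu]_(x in D) f x = \int[mu]_(x in D) g x)%E.
Proof.
move=> f0 g0 fg; apply/eqP; rewrite eq_le !ae_le_integral//.
- by apply: filterS fg => x fg Dx; rewrite fg.
- by apply: filterS fg => x fg Dx; rewrite fg.
Qed.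

Lemma limn_einf_ge (u : (\bar R)^nat) (a : \bar R) :
  (\forall N \near \oo, (a <= u N)%E) -> (a <= limn_einf u)%E.
Proof.
move=> [N _ au]; rewrite limn_einf_lim; apply: lime_ge.
  exact: is_cvg_einfs.
exists N => // n /= Nn; apply: le_ereal_inf_tmp => _ [m /= nm <-].
by apply: au => /=; exact: leq_trans nm.
Qed.

Lemma limn_einf_le (u : (\bar R)^nat) (a : \bar R) :
  (forall N, (u N <= a)%E) -> (limn_einf u <= a)%E.
Proof.
move=> ua; rewrite limn_einf_lim; apply: lime_le.
  exact: is_cvg_einfs.
apply: nearW => n; apply: le_trans (ua n).
by apply: ereal_inf_lbound; exists n => /=.
Qed.

(** Fatou's lemma for the measurable [u N]. The function [f], later a maximal function, enters only
    through the reals below its values, so that it may be infinite. *)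
Lemma fatou_bound (u : nat -> T -> R) f (B : \bar R) :
  (forall N, measurable_fun setT (u N)) -> (forall N x, 0 <= u N x) ->
  (forall x, (0 <= f x)%E) ->
  {ae mu, forall x (r : R), (r%:E < f x)%E -> \forall N \near \oo,
    r <= u N x} ->
  (forall N, (\int[mu]_x (u N x)%:E <= B)%E) ->
  (\int[mu]_x f x <= B)%E.
Proof.
move=> mu_ u0 f0 fu uB.
pose v N x := (u N x)%:E.
have v0 N x : (0 <= v N x)%E by rewrite lee_fin.
have l0 x : (0 <= limn_einf (v^~ x))%E by apply: limn_einf_ge; exact: nearW.
apply: (@le_trans _ _ (\int[mu]_x limn_einf (v^~ x))%E).
  apply: ae_le_integral => // .
  apply: filterS fu => x fx _.
  have {}fx (r : R) : (r%:E < f x)%E -> (r%:E <= limn_einf (v^~ x))%E.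
    by move=> /fx ur; apply: limn_einf_ge; apply: filterS ur => N;
      rewrite lee_fin.
  rewrite leNgt; apply/negP; move: (limn_einf _) fx (l0 x) => [l| |];
    [|by move=> _ _; rewrite ltNge leey|by []].
  move=> fx _; case: (f x) fx => [y| |]// fx ly.
    have := fx ((l + y) / 2); rewrite !lte_fin in ly *; rewrite lee_fin.
    by move=> /(_ ltac:(lra)); lra.
  by have := fx (l + 1); rewrite ltry lee_fin => /(_ isT); lra.
apply: (le_trans (fatou mu measurableT (f := v) _ _)) => //.
  by move=> N; exact/measurable_EFinP.
exact: limn_einf_le.
Qed.

End nonneg_integral.

Section real_integral.
Context d (T : measurableType d) (R : realType).
Variable mu : {measure set T -> \bar R}.
Variable D : set T.
Hypothesis mD : measurable D.
Implicit Types f g : T -> R.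

Lemma integralD_real f g : measurable_fun setT f -> measurable_fun setT g ->
  (forall x, 0 <= f x) -> (forall x, 0 <= g x) ->
  (\int[mu]_(x in D) (f x + g x)%:E =
   \int[mu]_(x in D) (f x)%:E + \int[mu]_(x in D) (g x)%:E)%E.
Proof.
move=> mf mg f0 g0; under eq_integral do rewrite EFinD.
rewrite ge0_integralD//; try by move=> x _; rewrite lee_fin.
all: by apply/measurable_EFinP; exact: measurable_funTS.
Qed.

Lemma integralZ_real (k : R) f : measurable_fun setT f -> 0 <= k ->
  (forall x, 0 <= f x) ->
  (\int[mu]_(x in D) (k * f x)%:E = k%:E * \int[mu]_(x in D) (f x)%:E)%E.
Proof.
move=> mf k0 f0; under eq_integral do rewrite EFinM.
rewrite ge0_integralZl_EFin//; first by move=> x _; rewrite lee_fin.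
by apply/measurable_EFinP; exact: measurable_funTS.
Qed.

Lemma le_integral_real f g : (forall x, D x -> 0 <= f x) ->
  (forall x, D x -> f x <= g x) ->
  (\int[mu]_(x in D) (f x)%:E <= \int[mu]_(x in D) (g x)%:E)%E.
Proof.
move=> f0 fg; apply: ae_le_integral => [x Dx|x Dx|].
- by rewrite lee_fin f0.
- by rewrite lee_fin (le_trans (f0 _ Dx))// fg.
- by apply: nearW => x Dx; rewrite lee_fin fg.
Qed.

End real_integral.

(** * The martingale of averages *)

Section filtration.
Context d (T : measurableType d) (R : realType).
Variable mu : {measure set T -> \bar R}.
(* The k-th partition is given by the labels [c k x] of its cells. *)
Variable c : nat -> T -> nat.
Hypothesis mc : forall k i, measurable (c k @^-1` [set i]).
Hypothesis nested : forall k x y, c k.+1 x = c k.+1 y -> c k x = c k y.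
Implicit Types (u g v h G : T -> R) (k : nat) (x : T).

Definition cell k x : set T := c k @^-1` [set c k x].

(** The average of [g / u] for the measure [u dmu]: with [u = 1] it is the ordinary average of [g],
    with [g = G u] the weighted average of [G]. *)
Definition average u g k x : R :=
  fine (\int[mu]_(y in cell k x) (g y)%:E) /
  fine (\int[mu]_(y in cell k x) (u y)%:E).

(** Constancy on cells replaces measurability for the k-th partition. The codomain is arbitrary, so
    that the notion also applies to sets, as functions to [Prop]. *)
Definition adapted k (U : Type) (h : T -> U) :=
  forall x y, c k x = c k y -> h x = h y.

Lemma measurable_cell k x : measurable (cell k x).
Proof. exact: mc. Qed.

Lemma adapted_cell k : adapted k (cell k).
Proof. by move=> x y e; rewrite /cell e. Qed.

Lemma adapted_average u g k : adapted k (average u g k).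
Proof. by move=> x y e; rewrite /average (adapted_cell e). Qed.

Lemma nested_le j k x y : (j <= k)%N -> c k x = c k y -> c j x = c j y.
Proof.
elim: k => [|k ih]; first by rewrite leqn0 => /eqP ->.
by rewrite leq_eqVlt ltnS => /orP[/eqP ->//|/ih jk] /nested.
Qed.

Lemma adapted_le j k (U : Type) (h : T -> U) :
  (j <= k)%N -> adapted j h -> adapted k h.
Proof. by move=> jk ah x y /(nested_le jk); exact: ah. Qed.

Lemma cell_sub j k x : (j <= k)%N -> cell k x `<=` cell j x.
Proof. by move=> jk y; exact: nested_le. Qed.

(** Labels are natural numbers, so the preimage of any set is a countable union of cells. *)
Lemma adapted_preimage k (U : Type) (h : T -> U) (S : set U) :
  adapted k h -> measurable (h @^-1` S).
Proof.
move=> ah; have -> : h @^-1` S =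
    \bigcup_(i in c k @` (h @^-1` S)) (c k @^-1` [set i]).
  apply/seteqP; split=> [x Sx|x [_ [y Sy <-]] /= xy].
    by exists (c k x) => //; exists x.
  by rewrite /= (ah _ _ xy).
by apply: bigcup_measurable => i _; exact: mc.
Qed.

Lemma measurable_adapted k h : adapted k h -> measurable_fun setT h.
Proof. by move=> ah _ Y mY; rewrite setTI; exact: adapted_preimage ah. Qed.

Lemma integral_cells k (f : T -> \bar R) :
  measurable_fun setT f -> (forall x, (0 <= f x)%E) ->
  (\int[mu]_x f x = \sum_(i <oo) \int[mu]_(x in c k @^-1` [set i]) f x)%E.
Proof.
move=> mf f0; have cT : [set: T] = \bigcup_i (c k @^-1` [set i]).
  by apply/seteqP; split => // x _; exists (c k x).
rewrite cT ge0_integral_bigcup//; first by rewrite -cT.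
by apply/trivIsetP => i j _ _ ij; apply/seteqP; split => // x [/= -> /eqP];
  rewrite (negbTE ij).
Qed.

Lemma eq_integral_cells k (f g : T -> \bar R) :
  measurable_fun setT f -> (forall x, (0 <= f x)%E) ->
  measurable_fun setT g -> (forall x, (0 <= g x)%E) ->
  (forall x, \int[mu]_(y in cell k x) f y = \int[mu]_(y in cell k x) g y)%E ->
  (\int[mu]_x f x = \int[mu]_x g x)%E.
Proof.
move=> mf f0 mg g0 fg; rewrite !(@integral_cells k)//.
apply: eq_eseriesr => i _; have [->|/set0P[x /= xi]] :=
  eqVneq (c k @^-1` [set i]) set0.
  by rewrite !integral_set0.
by have := fg x; rewrite /cell xi.
Qed.

Lemma le_integral_cells k (f g : T -> \bar R) :
  measurable_fun setT f -> (forall x, (0 <= f x)%E) ->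
  measurable_fun setT g -> (forall x, (0 <= g x)%E) ->
  (forall x, \int[mu]_(y in cell k x) f y <= \int[mu]_(y in cell k x) g y)%E ->
  (\int[mu]_x f x <= \int[mu]_x g x)%E.
Proof.
move=> mf f0 mg g0 fg; rewrite !(@integral_cells k)//.
apply: lee_nneseries => [i _ _|i _]; first by apply: integral_ge0.
have [->|/set0P[x /= xi]] := eqVneq (c k @^-1` [set i]) set0.
  by rewrite !integral_set0.
by have := fg x; rewrite /cell xi.
Qed.

Section average.
Variables u g : T -> R.
Hypotheses (mu_ : measurable_fun setT u) (mg : measurable_fun setT g).
Hypotheses (u0 : forall x, 0 <= u x) (g0 : forall x, 0 <= g x).
Hypothesis u_cell : forall k x, (0 < \int[mu]_(y in cell k x) (u y)%:E < +oo)%E.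
Hypothesis g_cell : forall k x, (\int[mu]_(y in cell k x) (g y)%:E < +oo)%E.

Lemma average_ge0 k x : 0 <= average u g k x.
Proof.
by rewrite divr_ge0// fine_ge0//; apply: integral_ge0 => y _; rewrite lee_fin.
Qed.

Lemma averageE k x : ((average u g k x)%:E * \int[mu]_(y in cell k x) (u y)%:E =
  \int[mu]_(y in cell k x) (g y)%:E)%E.
Proof.
have /andP[up uo] := u_cell k x; rewrite /average.
have fu : (\int[mu]_(y in cell k x) (u y)%:E)%E \is a fin_num.
  by rewrite ge0_fin_numE// ltW.
have fg : (\int[mu]_(y in cell k x) (g y)%:E)%E \is a fin_num.
  by rewrite ge0_fin_numE//; apply: integral_ge0 => y _; rewrite lee_fin.
rewrite -[X in (_ * X)%E](fineK fu) -[RHS](fineK fg) -EFinM divfK//.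
by rewrite gt_eqF// fine_gt0// up.
Qed.

Lemma measurable_average k : measurable_fun setT (average u g k).
Proof. exact: measurable_adapted (@adapted_average u g k). Qed.

(** The martingale property: on each cell [h] and the average are constant, so that the average is a
    conditional expectation. *)
Lemma integral_adapted_average k h : adapted k h -> (forall x, 0 <= h x) ->
  (\int[mu]_x (h x * average u g k x * u x)%:E = \int[mu]_x (h x * g x)%:E)%E.
Proof.
move=> ah h0; have mh := measurable_adapted ah; apply: (@eq_integral_cells k).
- apply/measurable_EFinP; apply: measurable_funM => //.
  by apply: measurable_funM => //; exact: measurable_average.
- by move=> x; rewrite lee_fin mulr_ge0// mulr_ge0//; exact: average_ge0.
- by apply/measurable_EFinP; exact: measurable_funM.
- by move=> x; rewrite lee_fin !mulr_ge0.
move=> x.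
under eq_integral => y /set_mem xy do
  rewrite (ah _ _ xy) (adapted_average u g xy).
rewrite integralZ_real//; [|exact: measurable_cell|by rewrite mulr_ge0//;
  exact: average_ge0].
rewrite EFinM -muleA averageE.
under [RHS]eq_integral => y /set_mem xy do rewrite (ah _ _ xy).
by rewrite integralZ_real//; exact: measurable_cell.
Qed.

End average.
End filtration.

(** * Maximal inequality *)

Ltac nneg := solve [repeat first [done | exact: ltW | apply: powR_ge0
  | apply: mulr_ge0
  | lazymatch goal with |- is_true (@Order.le ring_display _ _ _) => lra end
  | apply: addr_ge0]].

(** * Pointwise inequalities derived from Young's inequality *)

Section power_inequalities.
Context (R : realType).
Implicit Types a b p m x : R.

(** Young's inequality with the conjugate exponents [p / (p - 1)] and [p], applied to [a^(p-1)] and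
    [b]. *)
Lemma young_powR p a b : 1 < p -> 0 <= a -> 0 <= b ->
  p * (a `^ (p - 1) * b) <= (p - 1) * a `^ p + b `^ p.
Proof.
move=> p1 a0 b0; have p0 : 0 < p by lra.
have pm : 0 < p - 1 by lra.
have pq : (p / (p - 1))^-1 + p^-1 = 1.
  by rewrite invf_div -[X in _ + X]mul1r -mulrDl subrK divff// gt_eqF.
have := conjugate_powR (powR_ge0 a (p - 1)) b0 (divr_gt0 p0 pm) p0 pq.
rewrite -powRrM mulrC [(p - 1) * _]mulrC divfK ?gt_eqF// invf_div => H.
have := ler_wpM2l (ltW p0) H; rewrite mulrC => /le_trans; apply.
rewrite le_eqVlt; apply/orP; left; apply/eqP; field.
by rewrite gt_eqF.
Qed.

(** Rescaling [a] by [2^(-1/p)] and [b] by [2^((p-1)/p)] preserves [a^(p-1) b] and halves the term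
    in [a^p], which can then be absorbed. *)
Lemma young_powR_half p a b : 1 < p -> 0 <= a -> 0 <= b ->
  p * (a `^ (p - 1) * b) <= (p - 1) / 2 * a `^ p + 2 `^ (p - 1) * b `^ p.
Proof.
move=> p1 a0 b0; have p0 : p != 0 by rewrite gt_eqF//; lra.
have /= := @young_powR p (a * 2 `^ (- p^-1)) (b * 2 `^ ((p - 1) / p)) p1
  (mulr_ge0 a0 (powR_ge0 _ _)) (mulr_ge0 b0 (powR_ge0 _ _)).
rewrite !powRM ?powR_ge0// -!powRrM.
have -> : - p^-1 * (p - 1) = - ((p - 1) / p) by rewrite mulNr mulrC.
rewrite mulrACA -powRD; last by apply/implyP.
rewrite addNr powRr0 mulr1 mulNr mulVf// divfK// powR_inv1//.
by rewrite [b `^ p * _]mulrC mulrA mulrAC.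
Qed.

(* This is [Phi(m', x) <= Phi(m, x)] for Burkholder's function
   [Phi(m, x) = (p - 1) m^p - p m^(p-1) x]. *)
Lemma doob_step p m x : 1 < p -> 0 <= m -> 0 <= x ->
  (p - 1) * Num.max m x `^ p + p * (m `^ (p - 1) * x) <=
  (p - 1) * m `^ p + p * (Num.max m x `^ (p - 1) * x).
Proof.
move=> p1 m0 x0; have [mx|xm] := leP m x; last exact: lexx.
(* Here the maximum is [x], and the two terms in [x^p] differ by exactly the [x^p] of Young's
   inequality. *)
have := young_powR p1 m0 x0.
rewrite [x `^ (p - 1) * x]mulrC mulr_powRB1//; lra.
Qed.

End power_inequalities.

Lemma measurable_fun_powR d (T : measurableType d) (R : realType) (h : T ->
  R) s :
  measurable_fun setT h -> measurable_fun setT (fun x => h x `^ s).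
Proof.
by move=> mh; apply: (measurableT_comp (measurable_powR s) mh).
Qed.

Section running_max.
Context (T : Type) (R : realType).
Implicit Types A : nat -> T -> R.

Fixpoint running_max A k x : R :=
  if k is j.+1 then Num.max (running_max A j x) (A k x) else A 0%N x.

Lemma running_max_ge A j k x : (j <= k)%N -> A j x <= running_max A k x.
Proof.
elim: k => [|k ih]; first by rewrite leqn0 => /eqP ->.
rewrite leq_eqVlt ltnS => /orP[/eqP -> /=|/ih jk /=].
  by rewrite le_max lexx orbT.
by rewrite le_max jk.
Qed.

Lemma running_max_ge0 A k x : (forall j, 0 <= A j x) -> 0 <= running_max A k x.
Proof. by move=> A0; exact: le_trans (A0 0%N) (running_max_ge A x (leq0n k)).
  Qed.

Lemma running_max_le A k x b :
  (forall j, (j <= k)%N -> A j x <= b) -> running_max A k x <= b.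
Proof.
elim: k => [|k ih] Ab /=; first exact: Ab.
by rewrite ge_max Ab// ih// => j jk; apply: Ab; exact: leqW.
Qed.

End running_max.

Lemma adapted_running_max d (T : measurableType d) (R : realType) (c : nat ->
  T -> nat)
    (A : nat -> T -> R) k :
  (forall k x y, c k.+1 x = c k.+1 y -> c k x = c k y) ->
  (forall j, adapted c j (A j)) -> adapted c k (running_max A k).
Proof.
move=> nested aA; elim: k => [|k ih] x y xy /=; first exact: aA.
by rewrite (ih _ _ (nested _ _ _ xy)) (aA k.+1 _ _ xy).
Qed.

Lemma le_absorb_half (R : realType) (a b : \bar R) (s t : R) : 0 < s ->
  a \is a fin_num -> b \is a fin_num ->
  (s%:E * a <= (s / 2)%:E * a + t%:E * b)%E -> (a <= (2 * t / s)%:E * b)%E.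
Proof.
case: a b => [a||] [b||]// s0 _ _; rewrite -!EFinM -EFinD !lee_fin => sab.
rewrite mulrAC ler_pdivlMr//; lra.
Qed.

(** * Jensen's and Doob's inequalities for weighted averages *)

Section maximal_inequality.
Context d (T : measurableType d) (R : realType).
Variable mu : {measure set T -> \bar R}.
Variable c : nat -> T -> nat.
Hypothesis mc : forall k i, measurable (c k @^-1` [set i]).
Hypothesis nested : forall k x y, c k.+1 x = c k.+1 y -> c k x = c k y.
Variables (p : R) (u G : T -> R).
Hypothesis p1 : 1 < p.
Hypotheses (mu_ : measurable_fun setT u) (mG : measurable_fun setT G).
Hypotheses (u0 : forall x, 0 <= u x) (G0 : forall x, 0 <= G x).
Hypothesis u_cell :
  forall k x, (0 < \int[mu]_(y in cell c k x) (u y)%:E < +oo)%E.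
Hypothesis Gp : (\int[mu]_x (G x `^ p * u x)%:E < +oo)%E.

Let g x := G x * u x.
Let A := average mu c u g.
Let M := running_max A.

Let mg : measurable_fun setT g. Proof. exact: measurable_funM. Qed.
Let g0 x : 0 <= g x. Proof. by rewrite mulr_ge0. Qed.
Let mGp : measurable_fun setT (fun x => G x `^ p * u x).
Proof. by apply: measurable_funM => //; exact: measurable_fun_powR. Qed.
Let Gp0 x : 0 <= G x `^ p * u x. Proof. nneg. Qed.

Let Gp_sub (D : set T) : measurable D ->
  (\int[mu]_(x in D) (G x `^ p * u x)%:E < +oo)%E.
Proof.
move=> mD; apply: le_lt_trans Gp; apply: ge0_subset_integral => //.
  by apply/measurable_EFinP.
by move=> x _; rewrite lee_fin.
Qed.

Let p0 : 0 < p. Proof. by move: p1; lra. Qed.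

(** Young's inequality with [a = 1] gives [G <= 1 + G^p], and both [u] and [G^p u] have finite
    integral over the cell. *)
Lemma average_weight_lty k x : (\int[mu]_(y in cell c k x) (g y)%:E < +oo)%E.
Proof.
have mC := measurable_cell mc k x.
have /andP[_ uo] := u_cell k x.
apply: (@le_lt_trans _ _ (\int[mu]_(y in cell c k x) (u y + G y `^ p * u
  y)%:E)%E).
  apply: le_integral_real => // y _; rewrite /g -[X in X + _]mul1r -mulrDl.
  apply: ler_wpM2r => //; have := young_powR p1 ler01 (G0 y).
  have /= := powR_ge0 (G y) p; rewrite !powR1 mul1r; move: p1; nra.
by rewrite integralD_real// lte_add_pinfty// Gp_sub.
Qed.

Let A0 k x : 0 <= A k x. Proof. exact: average_ge0. Qed.

(** Jensen's inequality, by integrating [p a^(p-1) G <= (p-1) a^p + G^p] against [u], where [a] is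
    the average itself. *)
Lemma jensen_average k x :
  ((A k x `^ p)%:E * \int[mu]_(y in cell c k x) (u y)%:E <=
   \int[mu]_(y in cell c k x) (G y `^ p * u y)%:E)%E.
Proof.
have mC := measurable_cell mc k x.
have /andP[up uo] := u_cell k x.
set a := A k x; have a0 : 0 <= a by exact: A0.
have : (\int[mu]_(y in cell c k x) ((p * a `^ (p - 1)) * g y)%:E <=
        \int[mu]_(y in cell c k x) ((p - 1) * a `^ p * u y + G y `^ p * u
          y)%:E)%E.
  apply: le_integral_real => y _; first nneg.
  rewrite /g -mulrDl !mulrA; apply: ler_wpM2r => //.
  by have := young_powR p1 a0 (G0 y); rewrite mulrA.
have pm : 0 <= p - 1 by move: p1; lra.
rewrite integralD_real//; last 2 first.
- exact: measurable_funM.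
- by move=> y; nneg.
rewrite !integralZ_real//; try nneg.
rewrite -(averageE g0 u_cell average_weight_lty) -/A -/a.
have ufin : (\int[mu]_(y in cell c k x) (u y)%:E)%E \is a fin_num.
  by rewrite ge0_fin_numE// ltW.
have Gfin : (\int[mu]_(y in cell c k x) (G y `^ p * u y)%:E)%E \is a fin_num.
  rewrite ge0_fin_numE ?Gp_sub//; apply: integral_ge0 => y _.
  by rewrite lee_fin.
rewrite -(fineK ufin) -(fineK Gfin) -!EFinM -!EFinD !lee_fin.
move: (fine _) (fine _) => U V; rewrite -(@mulr_powRB1 _ a p)//; lra.
Qed.

Lemma integral_average_powR k :
  (\int[mu]_x (A k x `^ p * u x)%:E <= \int[mu]_x (G x `^ p * u x)%:E)%E.
Proof.
have mA : measurable_fun setT (fun x => A k x `^ p * u x).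
  by apply: measurable_funM => //; apply: measurable_fun_powR; exact:
    measurable_average.
apply: (@le_integral_cells _ _ _ mu c mc k).
- exact/measurable_EFinP.
- by move=> x; rewrite lee_fin mulr_ge0// powR_ge0.
- exact/measurable_EFinP.
- by move=> x; rewrite lee_fin.
move=> x; under eq_integral => y /set_mem xy do
  rewrite /A (adapted_average mu u g xy) -/A.
by rewrite integralZ_real//; [exact: jensen_average|exact:
  measurable_cell|exact: powR_ge0].
Qed.

Let M0 k x : 0 <= M k x. Proof. exact: running_max_ge0. Qed.

Let aM k : adapted c k (M k).
Proof. by apply: adapted_running_max => // j; exact: adapted_average. Qed.

Let mM k : measurable_fun setT (M k).
Proof. exact: (measurable_adapted mc (@aM k)). Qed.

Let mMp k s (h : T -> R) : measurable_fun setT h ->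
  measurable_fun setT (fun x => M k x `^ s * h x).
Proof. by move=> mh; apply: measurable_funM => //; exact:
  measurable_fun_powR. Qed.

(** A crude bound that grows with [k], from [M_(k+1)^p <= M_k^p + A_(k+1)^p]. It makes the later
    cancellations legitimate. *)
Let Mp_lty k : (\int[mu]_x (M k x `^ p * u x)%:E < +oo)%E.
Proof.
elim: k => [|k ih]; first exact: le_lt_trans (integral_average_powR 0) Gp.
apply: (@le_lt_trans _ _
  (\int[mu]_x (M k x `^ p * u x + A k.+1 x `^ p * u x)%:E)%E).
  apply: le_integral_real => x _; first nneg.
  rewrite -mulrDl; apply: ler_wpM2r => //; rewrite /M /=.
  by case: (leP (running_max A k x) (A k.+1 x)) => _;
    rewrite ?lerDl ?lerDr powR_ge0.
rewrite integralD_real//.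
- apply: lte_add_pinfty; first exact: ih.
  exact: le_lt_trans (integral_average_powR _) Gp.
- exact: mMp.
- by apply: measurable_funM => //; apply: measurable_fun_powR; exact:
  measurable_average.
- by move=> x; nneg.
- by move=> x; nneg.
Qed.

Let Mpg_lty k : (\int[mu]_x (M k x `^ (p - 1) * g x)%:E < +oo)%E.
Proof.
apply: (@le_lt_trans _ _
  (\int[mu]_x (M k x `^ p * u x + G x `^ p * u x)%:E)%E).
  apply: le_integral_real => x _; first nneg.
  rewrite /g mulrA -mulrDl; apply: ler_wpM2r => //.
  have := young_powR p1 (M0 k x) (G0 x).
  have := powR_ge0 (M k x) p; have := powR_ge0 (G x) p; move: p1; nra.
rewrite integralD_real//.
- by apply: lte_add_pinfty; [exact: Mp_lty|exact: Gp].
- exact: mMp.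
- by move=> x; nneg.
Qed.

(** The integral of [(p-1) M_k^p - p M_k^(p-1) A_k] against [u] does not increase with [k] and is
    nonpositive for [k = 0], where [M_0 = A_0]. The two terms stay on opposite sides to avoid
    subtraction, and [A_k u] is replaced by [g]. *)
Let burkholder k : (\int[mu]_x ((p - 1) * (M k x `^ p * u x))%:E <=
  \int[mu]_x (p * (M k x `^ (p - 1) * g x))%:E)%E.
Proof.
have pm : 0 <= p - 1 by move: p1; lra.
have r0 (s : R) k' (h : T -> R) x : 0 <= h x -> 0 <= M k' x `^ s * h x.
  by move=> ?; nneg.
have martingale j k' : adapted c k' (M j) ->
  (\int[mu]_x (p * (M j x `^ (p - 1) * A k' x * u x))%:E =
   \int[mu]_x (p * (M j x `^ (p - 1) * g x))%:E)%E.
  move=> aMj; have mMj : measurable_fun setT (fun x =>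
    M j x `^ (p - 1)) by exact: measurable_fun_powR.
  rewrite !integralZ_real ?ltW//.
  - congr *%E; apply: (integral_adapted_average mc mu_ mg u0 g0 u_cell
    average_weight_lty).
      by move=> x y /aMj ->.
    by move=> x; exact: powR_ge0.
  - by apply: measurable_funM => //; exact: measurable_fun_powR.
  - by move=> x; exact: r0.
  - by apply: measurable_funM => //; apply: measurable_funM => //; exact:
    measurable_average.
  - by move=> x; nneg.
have M0E : M 0 = A 0 by [].
have MSE j x : M j.+1 x = Num.max (M j x) (A j.+1 x) by [].
have mA := measurable_average mu mc u g : forall j, measurable_fun setT (A j).
clearbody M.
clearbody A.
elim: k => [|k ih].
  apply: (@le_trans _ _ (\int[mu]_x (p * (M 0 x `^ (p - 1) * A 0 x *
    u x))%:E)%E).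
    apply: le_integral_real => x _; first nneg.
    rewrite M0E; move: (A 0 x) (A0 0 x) => a a0.
    rewrite !mulrA; apply: ler_wpM2r => //; rewrite -mulrA.
    rewrite [_ `^ _ * _]mulrC mulr_powRB1//.
    by apply: ler_wpM2r; [exact: powR_ge0|lra].
  by rewrite martingale.
have m1 j s (h : T -> R) e : measurable_fun setT h ->
    measurable_fun setT (fun x => e * (M j x `^ s * h x)).
  by move=> mh; apply: measurable_funM => //; exact: mMp.
have m2 j k' : measurable_fun setT (fun x => p * (M j x `^ (p - 1) * A k' x *
  u x)).
  apply: measurable_funM => //; apply: measurable_funM => //.
  by apply: mMp; exact: mA.
have r2 j k' x : 0 <= p * (M j x `^ (p - 1) * A k' x * u x).
  nneg.
have r1 j x : 0 <= (p - 1) * (M j x `^ p * u x) by nneg.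
have : (\int[mu]_x ((p - 1) * (M k.+1 x `^ p * u x) +
                    p * (M k x `^ (p - 1) * A k.+1 x * u x))%:E <=
        \int[mu]_x ((p - 1) * (M k x `^ p * u x) +
                    p * (M k.+1 x `^ (p - 1) * A k.+1 x * u x))%:E)%E.
  apply: le_integral_real => x _; first by rewrite addr_ge0.
  rewrite MSE; move: (M k x) (M0 k x) (A k.+1 x) (A0 k.+1 x) => m m0 a a0.
  by rewrite !mulrA -!mulrDl; apply: ler_wpM2r => //; rewrite -!mulrA doob_step.
rewrite (integralD_real mu measurableT (m1 _ _ _ _ mu_) (m2 _ _) (r1 _)
  (r2 _ _)).
rewrite (integralD_real mu measurableT (m1 _ _ _ _ mu_) (m2 _ _) (r1 _)
  (r2 _ _)).
rewrite (martingale _ _ (adapted_le nested (leqnSn k) (@aM k))) (martingale _ _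
  (@aM k.+1)).
(* After the induction hypothesis the integral of [p M_k^(p-1) g] stands on both sides; it is finite
   and cancels. *)
move=> H; have {H ih} := le_trans H (leeD2r _ ih).
rewrite addeC leeD2lE; first exact.
rewrite ge0_fin_numE; last first.
  by apply: integral_ge0 => x _; rewrite lee_fin; nneg.
rewrite (integralZ_real mu measurableT (mMp _ _ mg) (ltW p0) (fun x =>
  r0 _ _ _ _ (g0 x))).
by apply: lte_mul_pinfty; [rewrite lee_fin ltW|by []|exact: Mpg_lty].
Qed.

(** Young's inequality bounds the right side of [burkholder] by half of its left side plus [2^(p-1)]
    times the integral of [G^p u]. Absorbing the half doubles the constant, whence [2^p / (p-1)]. *)
Lemma doob k : (\int[mu]_x (M k x `^ p * u x)%:E <=
  (2 `^ p / (p - 1))%:E * \int[mu]_x (G x `^ p * u x)%:E)%E.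
Proof.
have pm : 0 < p - 1 by move: p1; lra.
have pm2 : 0 <= (p - 1) / 2 by lra.
have : measurable_fun setT (fun x => M k x `^ p * u x) by exact: mMp.
move: (M k) (M0 k) (@Mp_lty k) (@burkholder k) => m m0 m_lty mG_ mMk.
have Mp0 x : 0 <= m x `^ p * u x by nneg.
have H : (\int[mu]_x (p * (m x `^ (p - 1) * g x))%:E <=
    \int[mu]_x ((p - 1) / 2 * (m x `^ p * u x) +
                2 `^ (p - 1) * (G x `^ p * u x))%:E)%E.
  apply: le_integral_real => x _.
    nneg.
  rewrite /g !mulrA -mulrDl; apply: ler_wpM2r => //.
  by have := young_powR_half p1 (m0 x) (G0 x); rewrite !mulrA.
move: (le_trans mG_ H).
have mZ (e : R) (h : T -> R) : measurable_fun setT h ->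
  measurable_fun setT (fun x => e * h x).
  by move=> mh; exact: measurable_funM.
rewrite (integralD_real mu measurableT (mZ _ _ mMk) (mZ _ _ mGp)); last 2 first.
- by move=> x; nneg.
- by move=> x; nneg.
rewrite (integralZ_real mu measurableT mMk (ltW pm) Mp0).
rewrite (integralZ_real mu measurableT mMk pm2 Mp0).
rewrite (integralZ_real mu measurableT mGp (powR_ge0 _ _) Gp0).
have Mfin : (\int[mu]_x (m x `^ p * u x)%:E)%E \is a fin_num.
  rewrite ge0_fin_numE; first exact: m_lty.
  by apply: integral_ge0 => x _; rewrite lee_fin.
have Gfin : (\int[mu]_x (G x `^ p * u x)%:E)%E \is a fin_num.
  rewrite ge0_fin_numE; first exact: Gp.
  by apply: integral_ge0 => x _; rewrite lee_fin.
rewrite -[2 `^ p](@mulr_powRB1 _ 2)//.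
exact: (le_absorb_half pm Mfin Gfin).
Qed.

End maximal_inequality.

(** * Reverse Hoelder inequality *)

Section reverse_hoelder_step.
Context (R : realType).
Implicit Types e m x y K : R.

(** Young's inequality for [x^e] and [1] with exponents [1/e] and [1/(1-e)]. *)
Lemma bernoulli_powR e x : 0 < e < 1 -> 0 <= x -> x `^ e <= 1 + e * (x - 1).
Proof.
move=> /andP[e0 e1] x0; have e1' : 0 < 1 - e by lra.
have := @conjugate_powR _ (x `^ e) 1 e^-1 (1 - e)^-1 (powR_ge0 _ _) ler01.
rewrite !invr_gt0 => /(_ e0 e1'); rewrite !invrK.
have -> : e + (1 - e) = 1 by lra.
by move=> /(_ erefl); rewrite -powRrM mulfV ?gt_eqF// powRr1// powR1; lra.
Qed.

(* This is [Psi(m', x) <= Psi(m, x)] for the function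
   [Psi(m, x) = m^e (K x - m)], whose averages are controlled as long as the
   jumps of the martingale are bounded by the factor [y]. *)
Lemma reverse_hoelder_step e K y m x : 0 < e < 1 -> 1 <= K ->
  e * (K - 1) * y <= 1 -> 0 <= m -> 0 <= x -> x <= y * m ->
  K * (Num.max m x `^ e * x) + m `^ e * m <=
  K * (m `^ e * x) + Num.max m x `^ e * Num.max m x.
Proof.
move=> e01 K1 eKy m0 x0 xym; have [mx|xm] := leP m x; last exact: lexx.
move: m0; rewrite le_eqVlt => /orP[/eqP m0|m0].
  have -> : x = 0 by apply/eqP; rewrite eq_le x0 andbT;
    rewrite -m0 mulr0 in xym.
  by rewrite -m0 !mulr0.
have [z zE] : exists z, x = m * z by exists (x / m);
  rewrite mulrC divfK// gt_eqF.
have z1 : 1 <= z by move: mx; rewrite zE ler_pMr.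
have zy : z <= y by move: xym; rewrite zE mulrC ler_pM2r.
have z0 : 0 <= z by lra.
have B := bernoulli_powR e01 z0.
have me := powR_ge0 m e.
rewrite zE powRM// ?(ltW m0)//.
(* Homogeneity has reduced the claim to [m = 1]. Bernoulli's inequality replaces [z^e] by
   [1 + e (z-1)], and the excess [e (K-1) z (z-1)] is at most [z - 1]. *)
suff H : (K - 1) * (z `^ e * z) + 1 <= K * z.
  have := ler_wpM2l (mulr_ge0 me (ltW m0)) H; lra.
have e0 : 0 < e by case/andP: e01.
have H1 : (K - 1) * (z `^ e * z) <= (K - 1) * ((1 + e * (z - 1)) * z).
  by apply: ler_wpM2l; [lra|apply: ler_wpM2r].
have H2 : e * (K - 1) * z <= 1.
  apply: le_trans eKy; apply: ler_wpM2l => //; nneg.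
have H3 : e * (K - 1) * z * (z - 1) <= 1 * (z - 1).
  by apply: ler_wpM2r => //; lra.
lra.
Qed.

End reverse_hoelder_step.

Lemma integral_indic_real d (T : measurableType d) (R : realType)
    (mu : {measure set T -> \bar R}) (D : set T) (f : T -> R) :
  (\int[mu]_(x in D) (f x)%:E = \int[mu]_x (\1_D x * f x)%:E)%E.
Proof.
rewrite integral_mkcond; apply: eq_integral => x _; rewrite patchE indicE.
by case: (x \in D); rewrite ?mul1r ?mul0r.
Qed.

Lemma indic_ge0 (T : Type) (R : realType) (D : set T) x : 0 <= \1_D x :> R.
Proof. by rewrite indicE. Qed.

Section reverse_hoelder.
Context d (T : measurableType d) (R : realType).
Variable mu : {measure set T -> \bar R}.
Variable c : nat -> T -> nat.
Hypothesis mc : forall k i, measurable (c k @^-1` [set i]).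
Hypothesis nested : forall k x y, c k.+1 x = c k.+1 y -> c k x = c k y.
Variable v : T -> R.
Hypotheses (mv : measurable_fun setT v) (v0 : forall x, 0 <= v x).
Hypothesis mu_cell :
  forall k x, (0 < \int[mu]_(y in cell c k x) (1 : R)%:E < +oo)%E.
Hypothesis v_cell :
  forall k x, (\int[mu]_(y in cell c k x) (v y)%:E < +oo)%E.

Let A := average mu c (fun=> 1) v.
Let M := running_max A.

Variables C Y e : R.
Hypotheses (C1 : 1 <= C) (Y1 : 1 <= Y) (e01 : 0 < e < 1).
Hypothesis eCY : e * (2 * C - 1) * Y <= 1.
Hypothesis A_step : forall k x, A k.+1 x <= Y * A k x.
Hypothesis A_A1 : forall j k x, (j <= k)%N -> A j x <= C * A k x.

Let A0 k x : 0 <= A k x. Proof. by apply: average_ge0. Qed.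
Let M0 k x : 0 <= M k x. Proof. exact: running_max_ge0. Qed.
Let mA k : measurable_fun setT (A k). Proof. exact: measurable_average. Qed.
Let aM k : adapted c k (M k).
Proof. by apply: adapted_running_max => // j; exact: adapted_average. Qed.
Let mM k : measurable_fun setT (M k).
Proof. exact: (measurable_adapted mc (@aM k)). Qed.

Let A_le k x : A k x <= Y ^+ k * A 0%N x.
Proof.
elim: k => [|k ih]; first by rewrite expr0 mul1r.
apply: (le_trans (A_step _ _)); rewrite exprS -[leRHS]mulrA.
by apply: ler_wpM2l => //; move: Y1; lra.
Qed.

Let M_le k x : M k x <= Y ^+ k * A 0%N x.
Proof.
apply: running_max_le => j jk; apply: (le_trans (A_le j x)).
by apply: ler_wpM2r; [exact: A0|exact: ler_weXn2l].
Qed.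

Let M_A k x : M k x <= C * A k x.
Proof. by apply: running_max_le => j jk; exact: A_A1. Qed.

(** Let [X_k] and [Z_k] be the integrals of [2 C M_k^e A_k] and [M_k^(1+e)] over the cell. The
    difference [X_k - Z_k] does not increase, and [M_k <= C A_k] gives [2 Z_k <= X_k]; hence
    [Z_k <= X_0]. This is the reason for the factor 2. *)
Lemma reverse_hoelder_running_max k x0 :
  (\int[mu]_(x in cell c 0 x0) (M k x `^ (1 + e))%:E <=
   (2 * C * A 0%N x0 `^ (1 + e))%:E * \int[mu]_(x in cell c 0 x0) (1 : R)%:E)%E.
Proof.
have e0 : 0 < e by case/andP: e01.
have powE z : 0 <= z -> z `^ (1 + e) = z `^ e * z.
  move=> z0; rewrite -(@mulr_powRB1 _ z (1 + e))//; last by lra.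
  by rewrite mulrC; congr (_ `^ _ * _); lra.
have C0 : 0 <= 2 * C by move: C1; lra.
set Q := cell c 0 x0; have mQ : measurable Q by exact: measurable_cell.
have I0 x : 0 <= \1_Q x :> R by exact: indic_ge0.
have mI : measurable_fun setT (\1_Q : T -> R) by exact: measurable_indic.
have aI j : adapted c j (\1_Q : T -> R).
  move=> x y /(nested_le nested (leq0n j)) xy.
  by rewrite !indicE; congr (nat_of_bool _)%:R; apply/idP/idP => /set_mem;
    rewrite /Q /cell /= => zQ; apply/mem_set; rewrite /= -zQ.
have AQ x : x \in Q -> A 0%N x = A 0%N x0.
  by move=> /set_mem xQ; exact: (adapted_average mu (fun=> 1) v xQ).
pose mart j l := fun x => \1_Q x * (M j x `^ e * A l x).
pose maxi j := fun x => \1_Q x * (M j x `^ e * M j x).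
have mart0 j l x : 0 <= 2 * C * mart j l x.
  by rewrite /mart; move: (A0 l x) => a; nneg.
have maxi0 j x : 0 <= maxi j x by rewrite /maxi; move: (M0 j x) => a; nneg.
have mmart j l : measurable_fun setT (fun x => 2 * C * mart j l x).
  apply: measurable_funM => //; apply: measurable_funM => //.
  by apply: measurable_funM => //; apply: measurable_fun_powR; exact: mM.
have mmaxi j : measurable_fun setT (maxi j).
  apply: measurable_funM => //; apply: measurable_funM => //.
  by apply: measurable_fun_powR; exact: mM.
pose X j := (\int[mu]_x (2 * C * mart j j x)%:E)%E.
pose Z j := (\int[mu]_x (maxi j x)%:E)%E.
(* Since [M j] is adapted to both generations, both sides equal the integral with [v] in place of
   the average. *)
have martingale j : (\int[mu]_x (2 * C * mart j j.+1 x)%:E = X j)%E.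
  have H l : adapted c l (M j) -> (\int[mu]_x (2 * C * mart j l x)%:E =
      \int[mu]_x (2 * C * (\1_Q x * M j x `^ e) * v x)%:E)%E.
    move=> al.
    rewrite -(@integral_adapted_average _ _ _ mu c mc (fun=>
      1) v _ mv _ v0 mu_cell v_cell l)//.
    - by apply: eq_integral => x _; rewrite mulr1 /mart !mulrA.
    - by move=> x y xy; rewrite (aI l _ _ xy) (al _ _ xy).
    - by move=> x; nneg.
  rewrite /X (H _ (@aM j)); apply: H.
  exact: (adapted_le nested (leqnSn j) (@aM j)).
have Z_fin j : Z j \is a fin_num.
  rewrite ge0_fin_numE; last by apply: integral_ge0 => x _; rewrite lee_fin.
  (* Iterating the jump condition bounds [M j] on [Q] by a constant; the dependence on [j] is
     harmless, as only finiteness is wanted. *)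
  pose b := Y ^+ j * A 0%N x0.
  apply: (@le_lt_trans _ _ (\int[mu]_(x in Q) ((b `^ e * b) * 1)%:E)%E).
    rewrite integral_indic_real; apply: le_integral_real => x _ //.
    rewrite /maxi mulr1; have [xQ|xQ] := boolP (x \in Q); last first.
      by rewrite indicE (negbTE xQ) !mul0r.
    apply: ler_wpM2l => //.
    have Mb : M j x <= b.
      rewrite /b -(AQ _ xQ); exact: M_le.
    apply: ler_pM => //; first exact: powR_ge0.
    by apply: ge0_ler_powR => //; rewrite ?nnegrE// ?(ltW e0)// (le_trans (M0 j
      x)).
  have b0 : 0 <= b by rewrite mulr_ge0// exprn_ge0//; move: Y1; lra.
  rewrite integralZ_real//; last by rewrite mulr_ge0// powR_ge0.
  apply: lte_mul_pinfty => //; first by rewrite lee_fin mulr_ge0// powR_ge0.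
  by case/andP: (mu_cell 0 x0).
have step j : (X j.+1 + Z j <= X j + Z j.+1)%E.
  have D1 : (X j.+1 + Z j = \int[mu]_x (2 * C * mart j.+1 j.+1 x + maxi j
    x)%:E)%E.
    exact/esym/(integralD_real mu measurableT (mmart j.+1 j.+1) (mmaxi j)
      (mart0 _ _) (maxi0 _)).
  have D2 : (X j + Z j.+1 = \int[mu]_x (2 * C * mart j j.+1 x + maxi j.+1
    x)%:E)%E.
    rewrite -(martingale j).
    exact/esym/(integralD_real mu measurableT (mmart j j.+1) (mmaxi j.+1)
      (mart0 _ _) (maxi0 _)).
  rewrite D1 D2; apply: le_integral_real => x _; first by rewrite addr_ge0.
  have AY : A j.+1 x <= Y * M j x.
    apply: (le_trans (A_step _ _)); apply: ler_wpM2l; first by move: Y1; lra.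
    exact: running_max_ge.
  have C21 : 1 <= 2 * C by move: C1; lra.
  have := reverse_hoelder_step e01 C21 eCY (M0 j x) (A0 j.+1 x) AY.
  rewrite /mart /maxi -[Num.max _ _]/(M j.+1 x).
  move: (M j x) (M j.+1 x) (A j.+1 x) => m m' a H.
  by have := ler_wpM2l (I0 x) H; lra.
have X_le j : (X j <= X 0%N + Z j)%E.
  elim: j => [|j ih].
    by apply: leeDl; apply: integral_ge0 => x _; rewrite lee_fin.
  have := le_trans (step j) (leeD2r (Z j.+1) ih).
  move: (X j.+1) (X 0%N) (Z j) (Z j.+1) (Z_fin j) => x x' z z' zfin.
  by rewrite addeAC leeD2rE.
have X_ge j : (Z j + Z j <= X j)%E.
  have D1 : (Z j + Z j = \int[mu]_x (maxi j x + maxi j x)%:E)%E.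
    exact/esym/(integralD_real mu measurableT (mmaxi j) (mmaxi j) (maxi0 _)
      (maxi0 _)).
  rewrite D1; apply: le_integral_real => x _; first by rewrite addr_ge0.
  rewrite /maxi /mart; have := M_A j x; have := powR_ge0 (M j x) e.
  move: (M j x) (A j x) => m a me ma.
  have := ler_wpM2l (mulr_ge0 (I0 x) me) ma; lra.
have ZX j : (Z j <= X 0%N)%E.
  have := le_trans (X_ge j) (X_le j).
  by move: (X 0%N) (Z j) (Z_fin j) => x z zfin; rewrite leeD2rE.
have -> : (\int[mu]_(x in Q) (M k x `^ (1 + e))%:E = Z k)%E.
  rewrite integral_indic_real; apply: eq_integral => x _.
  by rewrite powE//; exact: M0.
apply: (le_trans (ZX k)).
rewrite -integralZ_real//; last by rewrite mulr_ge0// powR_ge0.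
rewrite integral_indic_real; apply: le_integral_real => x _ //.
rewrite /mart mulr1 powE// -[M 0%N x]/(A 0%N x).
have [xQ|xQ] := boolP (x \in Q); last first.
  by rewrite indicE (negbTE xQ) !mul0r mulr0.
by rewrite (AQ _ xQ) mulrCA.
Qed.

End reverse_hoelder.

(** * Differentiation along a generating filtration *)

Section generated.
Context d (T : measurableType d) (R : realType).
Variable mu : {measure set T -> \bar R}.
Variable c : nat -> T -> nat.
Hypothesis mc : forall k i, measurable (c k @^-1` [set i]).
Hypothesis nested : forall k x y, c k.+1 x = c k.+1 y -> c k x = c k y.
Hypothesis generated : forall S : set (set T), sigma_algebra setT S ->
  (forall k x, S (cell c k x)) -> measurable `<=` S.

Definition symdiff (A B : set T) := (A `\` B) `|` (B `\` A).

(** Approximation in measure inside [D] by a union of cells of a single generation. *)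
Definition approximable (D A : set T) := measurable A /\
  forall eps : R, 0 < eps -> exists k (B : set T),
    adapted c k B /\ (mu (D `&` symdiff A B) < eps%:E)%E.

Lemma measurable_adapted_set k (B : set T) : adapted c k B -> measurable B.
Proof.
move=> aB; have -> : B = B @^-1` [set True].
  by apply/seteqP; split=> x /=; [move=> Bx; rewrite propeqE|move=> ->].
exact: (adapted_preimage mc [set True] aB).
Qed.

Lemma measurable_symdiff A B :
  measurable A -> measurable B -> measurable (symdiff A B).
Proof. by move=> mA mB; apply: measurableU; exact: measurableD. Qed.

Lemma approximable_set0 D : approximable D set0.
Proof.
split=> // eps eps0; exists 0%N, set0; split=> //.
by rewrite /symdiff !setD0 setU0 setI0 measure0 lte_fin.
Qed.

Lemma approximable_setC D A : approximable D A -> approximable D (~` A).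
Proof.
move=> [mA aA]; split; first exact: measurableC.
move=> eps /aA[k [B [aB AB]]]; exists k, (~` B); split.
  by move=> x y /aB xy; rewrite /setC /mkset xy.
rewrite (_ : symdiff _ _ = symdiff A B)// /symdiff.
by rewrite !setDE !setCK setUC (setIC _ A) (setIC _ B).
Qed.

Lemma approximable_setU D A A' : measurable D ->
  approximable D A -> approximable D A' -> approximable D (A `|` A').
Proof.
move=> mD [mA aA] [mA' aA']; split; first exact: measurableU.
move=> eps eps0; have eps2 : 0 < eps / 2 by lra.
have [k [B [aB AB]]] := aA _ eps2; have [k' [B' [aB' AB']]] := aA' _ eps2.
have mB := measurable_adapted_set aB; have mB' := measurable_adapted_set aB'.
exists (maxn k k'), (B `|` B'); split.
  move=> x y xy; have := adapted_le nested (leq_maxl k k') aB xy.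
  have := adapted_le nested (leq_maxr k k') aB' xy.
  by rewrite /setU /mkset => -> ->.
apply: (@le_lt_trans _ _ (mu (D `&` symdiff A B) + mu (D `&` symdiff A' B'))%E).
  apply: (@le_trans _ _ (mu ((D `&` symdiff A B) `|` (D `&` symdiff A' B')))).
    apply: le_measure; rewrite ?inE.
    - by apply: measurableI => //; apply: measurable_symdiff; exact:
      measurableU.
    - by apply: measurableU; apply: measurableI => //; exact:
      measurable_symdiff.
    move=> x [Dx [[[Ax|Ax] /not_orP[nB nB']]|[[Bx|Bx] /not_orP[nA nA']]]].
    + by left; split => //; left.
    + by right; split => //; left.
    + by left; split => //; right.
    + by right; split => //; right.
  apply: measureU2; apply: measurableI => //; exact: measurable_symdiff.
by rewrite (splitr eps) EFinD lteD.
Qed.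

(** The part of [D] in the union but missed by the first [m] sets decreases to the empty set, so its
    measure tends to 0 as [D] has finite measure. It remains to approximate a finite union. *)
Lemma approximable_bigcup D (F : (set T)^nat) : measurable D ->
  (mu D < +oo)%E ->
  (forall i, approximable D (F i)) -> approximable D (\bigcup_i F i).
Proof.
move=> mD Doo aF; have mF i : measurable (F i) by case: (aF i).
have mU : measurable (\bigcup_i F i) by exact: bigcup_measurable.
split=> // eps eps0; have eps2 : 0 < eps / 2 by lra.
pose G m := \big[setU/set0]_(i < m) F i.
have aG m : approximable D (G m).
  rewrite /G; elim: m => [|m ih]; first by rewrite big_ord0; exact:
    approximable_set0.
  by rewrite big_ord_recr /=; exact: approximable_setU.
have mG m : measurable (G m) by case: (aG m).
pose H m := D `&` ((\bigcup_i F i) `\` G m).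
have mH m : measurable (H m) by apply: measurableI => //; exact: measurableD.
have H0 : \bigcap_m H m = set0.
  apply/seteqP; split => // x Hx; have [_ [[i _ Fx] _]] := Hx 0%N I.
  have [_ [_]] := Hx i.+1 I; apply; rewrite /G -bigcup_mkord.
  by exists i => //=; exact: ltnSn.
have Hoo : (mu (H 0%N) < +oo)%E.
  by apply: le_lt_trans Doo; apply: le_measure; rewrite ?inE//; exact: subIsetl.
have nH : {homo H : n m / (n <= m)%N >-> (m <= n)%O}.
  move=> n m nm; apply/subsetPset; rewrite /H => x [Dx [Ux nG]]; split=> //.
  split=> // Gx; apply: nG; move: Gx; rewrite /G -!bigcup_mkord.
  by move=> [i /= im Fi]; exists i => //=; exact: leq_trans nm.
have := @nonincreasing_cvg_mu _ _ _ mu H Hoo mH.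
rewrite H0 measure0 => /(_ measurable0 nH) cvg0.
have [m Hm] : exists m, (mu (H m) < (eps / 2)%:E)%E.
  have : \forall m \near \oo, (mu (H m) < (eps / 2)%:E)%E.
    by apply: (cvg0 [set x | (x < (eps / 2)%:E)%E]); apply: open_ereal_lt';
      rewrite lte_fin.
  by move=> [m _ Hm]; exists m; exact: (Hm m (leqnn m)).
have [_ /(_ _ eps2)[k [B [aB GB]]]] := aG m.
have mB := measurable_adapted_set aB.
exists k, B; split => //.
apply: (@le_lt_trans _ _ (mu (H m) + mu (D `&` symdiff (G m) B))%E).
  apply: (@le_trans _ _ (mu (H m `|` (D `&` symdiff (G m) B)))).
    apply: le_measure; rewrite ?inE.
    - by apply: measurableI => //; exact: measurable_symdiff.
    - by apply: measurableU => //; apply: measurableI => //; exact: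
      measurable_symdiff.
    move=> x [Dx [[Ux nB]|[Bx nU]]].
    + by have [Gx|nG] := pselect (G m x); [right; split => //; left|left].
    + right; split => //; right; split => // Gx; apply: nU; move: Gx.
      by rewrite /G -bigcup_mkord => -[i _ Fi]; exists i.
  by apply: measureU2 => //; apply: measurableI => //; exact:
    measurable_symdiff.
by rewrite (splitr eps) EFinD lteD.
Qed.

(** The approximable sets form a sigma-algebra that contains the cells. *)
Lemma approximable_measurable D : measurable D -> (mu D < +oo)%E ->
  measurable `<=` approximable D.
Proof.
move=> mD Doo; apply: generated.
  split=> [|A|F]; first exact: approximable_set0.
  - by rewrite setTD; exact: approximable_setC.
  - exact: approximable_bigcup.
move=> k x; split; first exact: measurable_cell.
move=> eps eps0; exists k, (cell c k x); split.
  by move=> y z yz; rewrite /cell /preimage /mkset yz.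
by rewrite /symdiff setDv setU0 setI0 measure0 lte_fin.
Qed.

Section differentiation.
Variable v : T -> R.
Hypotheses (mv : measurable_fun setT v) (v0 : forall x, 0 <= v x).
Hypothesis mu_cell :
  forall k x, (0 < \int[mu]_(y in cell c k x) (1 : R)%:E < +oo)%E.
Hypothesis v_cell :
  forall k x, (\int[mu]_(y in cell c k x) (v y)%:E < +oo)%E.

Let A := average mu c (fun=> 1) v.
Let A0 k x : 0 <= A k x. Proof. by apply: average_ge0. Qed.
Let mA k : measurable_fun setT (A k). Proof. exact: measurable_average. Qed.

Section level_set.
Variables (x0 : T) (a : R).
Hypothesis a0 : 0 <= a.
Let D := cell c 0 x0.
Let N := [set x | [/\ D x, a < v x & forall k, A k x <= a]].

Let mD : measurable D. Proof. exact: measurable_cell. Qed.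

Let muD : (mu D < +oo)%E.
Proof.
by have /andP[_] := mu_cell 0 x0; rewrite integral_cst// mul1e.
Qed.

Let mN : measurable N.
Proof.
rewrite (_ : N = D `&` (v @^-1` `]a, +oo[ `&`
    \bigcap_k (A k @^-1` `]-oo, a]))).
  apply: measurableI => //; apply: measurableI.
    by rewrite -[X in measurable X]setTI; exact: mv.
  by apply: bigcap_measurable => // k _; rewrite -[X in measurable X]setTI;
    exact: mA.
apply/seteqP; split=> x /=.
  by move=> [Dx ax Ax]; split => //; split; [rewrite in_itv/= ax|
    move=> k _ /=; rewrite in_itv/= Ax].
move=> [Dx [ax Ax]]; split => //; first by rewrite in_itv/= andbT in ax.
by move=> k; have := Ax k I; rewrite /= in_itv.
Qed.

(** Were [N] a union of cells of one generation, this would follow from the averages being at most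
    [a]. In general [N] is approximated by such a union. *)
Let integral_level_set :
  (\int[mu]_(x in N) (v x)%:E <= a%:E * mu N)%E.
Proof.
have muN : mu N \is a fin_num.
  rewrite ge0_fin_numE//; apply: le_lt_trans muD.
  by apply: le_measure; rewrite ?inE// => x [].
apply/lee_addgt0Pr => eps eps0.
(* The final error is [a e + e], from the measure of [B'] and from the integral over [E]. *)
pose e := eps / (a + 1); have e0 : 0 < e by rewrite divr_gt0//; move: a0; lra.
pose f x := \1_D x * v x.
have mf : measurable_fun setT f by apply: measurable_funM.
have f0 x : 0 <= f x by rewrite mulr_ge0// indic_ge0.
have intf : mu.-integrable setT (EFin \o f).
  apply/integrableP; split; first exact/measurable_EFinP.
  under eq_integral => x _ do rewrite /= ger0_norm//.
  by rewrite -integral_indic_real; exact: v_cell.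
have [del [del0 fdel]] := integral_normr_continuous intf e0.
(* By absolute continuity [del] controls the integral of [v] over the error set, while [e] controls
   its measure. *)
have mine : 0 < Num.min del e by rewrite lt_min del0.
have [_ /(_ _ mine)[k [B [aB DB]]]] :=
  approximable_measurable mD muD mN.
have mB := measurable_adapted_set aB.
pose E := D `&` symdiff N B.
have mE : measurable E by apply: measurableI => //; exact: measurable_symdiff.
have vE : (\int[mu]_(x in E) (v x)%:E <= e%:E)%E.
  have Efin : (\int[mu]_(x in E) (v x)%:E)%E \is a fin_num.
    rewrite ge0_fin_numE; last by apply: integral_ge0 => x _; rewrite lee_fin.
    apply: le_lt_trans (v_cell 0 x0); apply: ge0_subset_integral => //.
    - exact/measurable_EFinP/measurable_funTS.
    - by move=> x _; rewrite lee_fin.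
    - by move=> x [].
  rewrite -(fineK Efin) lee_fin; apply/ltW.
  have := fdel E mE; rewrite (lt_le_trans DB) ?lee_fin ?ge_min ?lexx// =>
    /(_ isT).
  rewrite /Rintegral; congr (fine _ < _); apply: eq_integral =>
    x /set_mem[Dx _].
  by rewrite /= ger0_norm// /f indicE mem_set// mul1r.
(* Cells of [B] with average above [a] are discarded; they contain no point of [N]. *)
pose B' := (D `&` B) `&` (A k @^-1` `]-oo, a]).
have mAa : measurable (A k @^-1` `]-oo, a]).
  by rewrite -[X in measurable X]setTI; exact: mA.
have mB' : measurable B' by apply: measurableI => //; exact: measurableI.
have aB' : adapted c k (\1_B' : T -> R).
  move=> x y xy; rewrite !indicE; congr (nat_of_bool _)%:R.
  have H z z' : c k z = c k z' -> B' z -> B' z'.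
    move=> zz' [[Dz Bz] Az]; split; first split.
    - by rewrite /D /cell /= -(nested_le nested (leq0n k) zz').
    - by rewrite -(aB _ _ zz').
    - have Azz' : A k z = A k z' by exact: adapted_average zz'.
      by move: Az; rewrite /= Azz'.
  by apply/idP/idP => /set_mem ?; apply/mem_set; [exact: H xy _|exact:
    H (esym xy) _].
have vB' : (\int[mu]_(x in B') (v x)%:E <= a%:E * mu B')%E.
  rewrite integral_indic_real.
  rewrite -(@integral_adapted_average _ _ _ mu c mc (fun=> 1) v _ mv _ v0
    mu_cell v_cell k)//.
  rewrite -[mu B']mul1e -(integral_cst mu mB') -integralZ_real//.
  rewrite [leRHS]integral_indic_real; apply: le_integral_real => x _.
    by rewrite mulr1 mulr_ge0 ?indic_ge0//; exact: A0.
  rewrite !mulr1 indicE; have [/set_mem[_]|] := boolP (x \in B');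
    last by rewrite !mul0r.
  by rewrite !mul1r /= in_itv.
have NB'E : N `<=` B' `|` E.
  move=> x Nx; have [Dx ax Ax] := Nx.
  have [Bx|nB] := pselect (B x); first by left; split => //;
    rewrite /= in_itv /= Ax.
  by right; split => //; left.
have B'NE : B' `<=` N `|` E.
  move=> x [[Dx Bx] _]; have [Nx|nN] := pselect (N x); first by left.
  by right; split => //; right.
have muB' : (mu B' <= mu N + e%:E)%E.
  apply: (@le_trans _ _ (mu (N `|` E))).
    by apply: le_measure; rewrite ?inE//; exact: measurableU.
  apply: (le_trans (measureU2 mu mN mE)); apply: leeD2l.
  by apply: ltW; apply: (lt_le_trans DB); rewrite lee_fin ge_min lexx orbT.
apply: (@le_trans _ _ (\int[mu]_(x in B') (v x)%:E + \int[mu]_(x in E) (v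
  x)%:E)%E).
  rewrite (integral_indic_real mu N) (integral_indic_real mu B')
    (integral_indic_real mu E).
  have mI (S : set T) : measurable S -> measurable_fun setT (fun x =>
    \1_S x * v x).
    by move=> mS; apply: measurable_funM.
  have I0 (S : set T) x : 0 <= \1_S x * v x by rewrite mulr_ge0// indic_ge0.
  rewrite -(integralD_real mu measurableT (mI _ mB') (mI _ mE) (I0 _) (I0 _)).
  apply: le_integral_real => x _ //; rewrite -mulrDl; apply: ler_wpM2r => //.
  rewrite !indicE; have [/set_mem/NB'E[xB|xE]|_] := boolP (x \in N).
  - by rewrite (mem_set xB) lerDl.
  - by rewrite (mem_set xE) lerDr.
  - by rewrite addr_ge0.
apply: (le_trans (leeD vB' vE)).
apply: (@le_trans _ _ (a%:E * (mu N + e%:E) + e%:E)%E).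
  by apply: leeD2r; apply: lee_wpmul2l.
rewrite -(fineK muN) -EFinD -!EFinM -!EFinD lee_fin.
have : e * (a + 1) = eps by rewrite divfK// gt_eqF//; move: a0; lra.
lra.
Qed.

(** On [N] the function [v - a] is positive, yet its integral over [N] is at most 0. *)
Lemma negligible_level_set : mu.-negligible N.
Proof.
pose w x := Num.max (v x - a) 0.
have w0 x : 0 <= w x by rewrite le_max lexx orbT.
have mw : measurable_fun setT w.
  by apply: measurable_maxr => //; apply: measurable_funB.
have muN : mu N \is a fin_num.
  rewrite ge0_fin_numE//; apply: le_lt_trans muD.
  by apply: le_measure; rewrite ?inE// => x [].
have : (\int[mu]_(x in N) (w x)%:E <= 0)%E.
  have := integral_level_set.
  have -> : (\int[mu]_(x in N) (v x)%:E =
             \int[mu]_(x in N) (w x + a * 1)%:E)%E.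
    apply: eq_integral => x /set_mem[_ ax _]; congr EFin.
    by rewrite /w max_l; lra.
  rewrite (integralD_real mu mN mw)//; last by move=> x; rewrite mulr1.
  rewrite integralZ_real// (integral_cst mu mN) mul1e.
  by move: (mu N) muN (integral _ _ _) => [m||]// _ [z||]//;
    rewrite -?EFinM -?EFinD ?lee_fin ?gerDr// addye.
rewrite le_eqVlt ltNge integral_ge0 ?orbF; last by move=> x _; rewrite lee_fin.
move=> /eqP w_int.
have : (\int[mu]_(x in N) `|(w x)%:E| = 0)%E.
  by rewrite -w_int; apply: eq_integral => x _; rewrite gee0_abs// lee_fin.
move/(ae_eq_integral_abs mu mN (f := EFin \o w)) => [].
  exact/measurable_EFinP/measurable_funTS.
move=> Z [mZ Z0 NZ]; exists Z; split => // x Nx; apply: NZ => /= /(_ Nx)[].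
case: Nx => _ ax _; rewrite /w max_l; lra.
Qed.

End level_set.

(** If no average at [x] exceeds [r < v x], a rational between [r] and [v x] places [x] in one of
    countably many negligible level sets. The maximum with 0 keeps the levels nonnegative. *)
Lemma le_sup_average x0 : {ae mu, forall x, cell c 0 x0 x ->
  forall r : R, r < v x -> exists k, r < A k x}.
Proof.
pose N (q : rat) := [set x | [/\ cell c 0 x0 x, Num.max (ratr q) 0 < v x &
  forall k, A k x <= Num.max (ratr q) 0]].
pose F i := if unpickle i is Some q then N q else set0.
have NF : mu.-negligible (\bigcup_i F i).
  apply: negligible_bigcup => i; rewrite /F; case: unpickle => [q|].
    by apply: negligible_level_set; rewrite le_max lexx orbT.
  exact: negligible_set0.
apply: negligibleS NF => x /= /not_implyP[Dx /existsNP[r /not_implyP[rv nA]]].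
have vx0 : 0 < v x.
  rewrite lt_neqAle v0 andbT; apply/eqP => vx; apply: nA; exists 0%N.
  by apply: lt_le_trans (A0 0%N x); rewrite vx.
have [q] : exists q : rat, ratr q \in `]r, v x[ by exact: rat_in_itvoo.
rewrite in_itv /= => /andP[rq qv]; exists (pickle q); first exact: I.
rewrite /F pickleK; split; [exact: Dx|by rewrite gt_max qv|].
move=> k; apply: contrapT => /negP; rewrite -ltNge gt_max => /andP[qA _].
by apply: nA; exists k; exact: lt_trans qA.
Qed.

End differentiation.
End generated.

(** * The reverse Hoelder inequality for the weight itself *)

Section reverse_hoelder_inequality.
Context d (T : measurableType d) (R : realType).
Variable mu : {measure set T -> \bar R}.
Variable c : nat -> T -> nat.
Hypothesis mc : forall k i, measurable (c k @^-1` [set i]).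
Hypothesis nested : forall k x y, c k.+1 x = c k.+1 y -> c k x = c k y.
Hypothesis generated : forall S : set (set T), sigma_algebra setT S ->
  (forall k x, S (cell c k x)) -> measurable `<=` S.
Variable v : T -> R.
Hypotheses (mv : measurable_fun setT v) (v0 : forall x, 0 <= v x).
Hypothesis mu_cell :
  forall k x, (0 < \int[mu]_(y in cell c k x) (1 : R)%:E < +oo)%E.
Hypothesis v_cell :
  forall k x, (\int[mu]_(y in cell c k x) (v y)%:E < +oo)%E.

Let A := average mu c (fun=> 1) v.

(** The bound for the running maximum is uniform in [k], and almost everywhere the running maximum
    eventually exceeds each real below [v]; Fatou's lemma concludes. *)
Theorem reverse_hoelder (C Y e : R) x0 :
  1 <= C -> 1 <= Y -> 0 < e < 1 -> e * (2 * C - 1) * Y <= 1 ->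
  (forall k x, A k.+1 x <= Y * A k x) ->
  (forall j k x, (j <= k)%N -> A j x <= C * A k x) ->
  (\int[mu]_(x in cell c 0 x0) (v x `^ (1 + e))%:E <=
   (2 * C * A 0%N x0 `^ (1 + e))%:E * \int[mu]_(x in cell c 0 x0) (1 : R)%:E)%E.
Proof.
move=> C1 Y1 e01 eCY A_step A_A1.
have A0 k x : 0 <= A k x by apply: average_ge0.
pose M := running_max A.
have e0 : 0 < 1 + e by case/andP: e01; lra.
rewrite [leLHS]integral_indic_real.
apply: (@fatou_bound _ _ _ mu (fun k x => \1_(cell c 0 x0) x * M k x `^ (1 +
  e))).
- move=> k; apply: measurable_funM; first exact:
  measurable_indic (measurable_cell mc 0 x0).
  apply: measurable_fun_powR; apply: (measurable_adapted mc (k := k)).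
  by apply: adapted_running_max => // j; exact: adapted_average.
- by move=> k x; rewrite mulr_ge0// ?indic_ge0// powR_ge0.
- by move=> x; rewrite lee_fin mulr_ge0// ?indic_ge0// powR_ge0.
- apply: filterS (le_sup_average mc nested generated mv v0 mu_cell v_cell x0)
  => x xA r.
  rewrite lte_fin indicE; have [/set_mem Dx|_] := boolP (x \in _); last first.
    by rewrite !mul0r => r0; apply: nearW => k; rewrite mul0r ltW.
  rewrite !mul1r; have [r0|r0] := ltP r 0.
    by move=> _; apply: nearW => k; rewrite mul1r (le_trans (ltW r0))//
      powR_ge0.
  have rE : r = (r `^ (1 + e)^-1) `^ (1 + e).
    by rewrite -powRrM mulVf ?gt_eqF// powRr1.
  rewrite rE => rv.
  have {}rv : r `^ (1 + e)^-1 < v x.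
    by rewrite ltNge; apply/negP => vr; move: rv;
      rewrite ltNge => /negP; apply; apply: ge0_ler_powR;
      rewrite ?nnegrE ?powR_ge0 ?v0// ltW.
  have [j rA] := xA Dx _ rv; exists j => // k /= jk; rewrite mul1r.
  have rM : r `^ (1 + e)^-1 <= M k x.
    by apply: (le_trans (ltW rA)); exact: running_max_ge.
  apply: ge0_ler_powR; rewrite ?nnegrE ?powR_ge0//; first exact: ltW.
  by apply: le_trans rM; exact: powR_ge0.
- move=> k; rewrite -(integral_indic_real mu _ (fun x => M k x `^ (1 + e))).
  exact: (@reverse_hoelder_running_max _ _ _ mu c mc nested v mv v0 mu_cell
    v_cell C Y e).
Qed.

End reverse_hoelder_inequality.

(** * Dyadic grids *)

Lemma adapted_sigma_algebra d (T : measurableType d) (c : nat -> T -> nat) k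
    (S : set (set T)) (B : set T) :
  sigma_algebra setT S -> (forall x, S (cell c k x)) -> adapted c k B -> S B.
Proof.
move=> [S0 _ SU] Sc aB.
pose F m := B `&` c k @^-1` [set m].
have -> : B = \bigcup_m F m.
  apply/seteqP; split=> [x Bx|x [m _ []]//].
  by exists (c k x) => //; split.
apply: SU => m; have [->//|/set0P[x [Bx /= xm]]] := eqVneq (F m) set0.
rewrite (_ : F m = cell c k x) //; apply/seteqP; split=> y.
  by move=> [_ /= ym]; rewrite /cell /= ym xm.
by rewrite /cell /= => yx; split; rewrite /= ?yx ?xm// (aB _ _ yx).
Qed.

(** An integer [j] is at most [floor z] exactly when [2 j] is at most [floor (2 z)]. This makes the
    dyadic grids nested. *)
Lemma floor_double (R : realType) (x y : R) :
  Num.floor (2 * x) = Num.floor (2 * y) -> Num.floor x = Num.floor y.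
Proof.
have H (z : R) (j : int) : (j <= Num.floor z) = (2 * j <= Num.floor (2 * z)).
  by rewrite !floor_ge_int intrM ler_pM2l.
move=> xy; apply/eqP; rewrite eq_le; apply/andP; split.
  by rewrite H -xy -H.
by rewrite H xy -H.
Qed.

Lemma intrD1 (R : nzRingType) (m : int) : (m + 1)%:~R = m%:~R + 1 :> R.
Proof. by rewrite intrD. Qed.

Section box.
Context (R : realType).

(** Half-open, so that the boxes of a grid partition the space. *)
Definition box n (a : 'I_n -> R) (l : R) : set (euclidean R n) :=
  [set y | forall i, a i <= (tnth y i : R) < a i + l].

Lemma measurable_box n (a : 'I_n -> R) l : measurable (box a l).
Proof.
rewrite (_ : box a l = \bigcap_(i in [set: 'I_n])
    ((fun y : euclidean R n => tnth y i) @^-1` [set` `[a i, a i + l[])).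
  apply: fin_bigcap_measurable => // i _.
  by rewrite -[X in measurable X]setTI; exact: measurable_tnth.
apply/seteqP; split => y.
  by move=> cy i _; rewrite /= in_itv/= cy.
by move=> cy i; have := cy i Logic.I; rewrite /= in_itv.
Qed.

Lemma lebesgue_box n (a : 'I_n -> R) l : 0 < l ->
  lebesgue R n (box a l) = (l ^+ n)%:E.
Proof.
move=> l0; elim: n a => [|n ih] a /=.
  rewrite /tuple0_measure diracE expr0 mem_set//.
  by case.
pose a' i := a (lift ord0 i).
rewrite /cons_measure /pushforward.
rewrite (_ : _ @^-1` _ = [set` `[a ord0, a ord0 + l[] `*` box a' l).
  rewrite product_measure1E//; last exact: measurable_box.
  rewrite [X in (_ * X)%E]ih exprS EFinM; congr (_ * _)%E.
  rewrite [LHS](@lebesgue_measure_itv R `[a ord0,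
    a ord0 + l[) /= lte_fin ltrDl l0.
  by rewrite -EFinB addrAC subrr add0r.
apply/seteqP; split => [[b y]|[b y]] /=.
  move=> H; split; first by rewrite in_itv/=; exact: (H ord0).
  by move=> i; have := H (lift ord0 i); rewrite tnthS.
rewrite in_itv /= => -[b0 H] i.
have [j ->|->] := unliftP ord0 i; last exact: b0.
by rewrite tnthS; exact: H.
Qed.

End box.

Section grid.
Context (R : realType) (n : nat).
Local Notation T := (euclidean R n).
Local Notation mu := (lebesgue R n).
Implicit Types (o : 'I_n -> R) (L : R) (x y : T).

(** The floors locate [x] in the grid of origin [o] and mesh [L / 2^k]; [pickle] turns them into the
    natural number required of a label. *)
Definition grid o L k x : nat :=
  pickle [ffun i => Num.floor (2 ^+ k * (((tnth x i : R) - o i) / L))].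

Lemma gridP o L k x y : (grid o L k y = grid o L k x) <->
  forall i, Num.floor (2 ^+ k * (((tnth y i : R) - o i) / L)) =
            Num.floor (2 ^+ k * (((tnth x i : R) - o i) / L)).
Proof.
split=> [/(pcan_inj pickleK)/ffunP xy i|xy]; first by have := xy i;
  rewrite !ffunE.
by congr pickle; apply/ffunP => i; rewrite !ffunE.
Qed.

Lemma grid_nested o L k x y : grid o L k.+1 x = grid o L k.+1 y ->
  grid o L k x = grid o L k y.
Proof.
move=> /gridP xy; apply/gridP => i; apply: floor_double.
by rewrite !mulrA -!exprS -!mulrA.
Qed.

Lemma grid_shift o L k : grid o L k = grid o (L / 2 ^+ k) 0.
Proof.
apply/funext => x; congr pickle; apply/ffunP => i; rewrite !ffunE.
by rewrite expr0 mul1r invf_div; congr Num.floor; rewrite mulrCA.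
Qed.

Definition corner o L k x i : R :=
  o i + (Num.floor (2 ^+ k * (((tnth x i : R) - o i) / L)))%:~R * (L / 2 ^+ k).

Lemma cell_grid o L k x : 0 < L ->
  cell (grid o L) k x = box (corner o L k x) (L / 2 ^+ k).
Proof.
move=> L0; have l0 : 0 < L / 2 ^+ k by rewrite divr_gt0// exprn_gt0.
have E (z : R) : 2 ^+ k * (z / L) = z / (L / 2 ^+ k).
  by rewrite invf_div mulrCA.
apply/seteqP; split=> y; rewrite /cell /=.
  move=> /gridP xy i; rewrite /corner -xy E.
  set z := (_ - o i); have -> : (tnth y i : R) = o i + z by rewrite /z; lra.
  have := floor_itv (z / (L / 2 ^+ k)).
  move: (Num.floor _) => m; rewrite ler_pdivlMr// ltr_pdivrMr// intrD1.
  move: (L / _) m%:~R => l b; lra.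
move=> H; apply/gridP => i; have := H i; rewrite /corner !E.
move: (Num.floor _) => m.
set z := (_ - o i); have -> : (tnth y i : R) = o i + z by rewrite /z; lra.
rewrite lerD2l -addrA ltrD2l => mz.
apply/eqP; rewrite floor_eq ler_pdivlMr// ltr_pdivrMr// intrD1.
move: (L / _) m%:~R mz => l b; lra.
Qed.

Lemma measurable_grid o L k i : 0 < L -> measurable (grid o L k @^-1` [set i]).
Proof.
move=> L0; have [->//|/set0P[x /= <-]] := eqVneq (grid o L k @^-1` [set i])
  set0.
by rewrite -/(cell _ _ _) cell_grid//; exact: measurable_box.
Qed.

Lemma lebesgue_cell o L k x : 0 < L ->
  mu (cell (grid o L) k x) = ((L / 2 ^+ k) ^+ n)%:E.
Proof. by move=> L0; rewrite cell_grid// lebesgue_box// divr_gt0// exprn_gt0.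
  Qed.

Lemma cell_sub_cube o L k x : 0 < L -> exists y : T,
  cell (grid o L) k x `<=` cube y (L / 2 ^+ k / 2).
Proof.
move=> L0; rewrite cell_grid//; set l := L / 2 ^+ k.
exists [tuple (corner o L k x i + l / 2 : measurableTypeR R) | i < n].
move=> y H i; rewrite tnth_mktuple ler_distl; have /andP[] := H i; lra.
Qed.

(** A half-space [x_i > a] is the union over [k] of the adapted sets where the i-th corner
    coordinate exceeds [a], because the mesh tends to 0. *)
Lemma grid_generated o L (S : set (set T)) : 0 < L -> sigma_algebra setT S ->
  (forall k x, S (cell (grid o L) k x)) -> measurable `<=` S.
Proof.
move=> L0 sS Sc; have [S0 SC SU] := sS.
apply: smallest_sub => //; apply: (big_ind (fun X => X `<=` S)) => //.
  by move=> X Y XS YS A [/XS|/YS].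
move=> i _ _ [B mB <-]; rewrite setTI.
pose S' : set (set R) := [set B | S ((fun x : T => tnth x i) @^-1` B)].
suff : measurable `<=` S' by move=> /(_ B); exact.
rewrite [X in X `<=` _](RGenOInfty.measurableE R); apply: smallest_sub.
  split; first by rewrite /S' /= preimage_set0.
    by move=> D; rewrite /S' /= !setTD preimage_setC -setTD; exact: SC.
  by move=> F SF; rewrite /S' /= preimage_bigcup; exact: SU.
move=> _ [a ->]; rewrite /S' /=.
pose E k := [set x : T | a < corner o L k x i].
rewrite (_ : _ @^-1` _ = \bigcup_k E k); last first.
  apply/seteqP; split=> x /=; last first.
    move=> [k _]; rewrite /E /= in_itv /= andbT => aE; apply: (lt_le_trans aE).
    have : cell (grid o L) k x x by [].
    by rewrite cell_grid// => /(_ i)/andP[].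
  rewrite in_itv /= andbT => ax.
  pose z := (tnth x i : R) - a; have z0 : 0 < z by rewrite subr_gt0.
  (* As [L / z < k <= 2^k], the mesh is smaller than the distance [z] to the boundary of the
     half-space. *)
  pose k := Num.bound (L / z); exists k => //; rewrite /E /=.
  have : cell (grid o L) k x x by [].
  rewrite cell_grid// => /(_ i)/andP[_ xc].
  suff : L / 2 ^+ k < z by move: xc; rewrite /z; lra.
  rewrite ltr_pdivrMr ?exprn_gt0// mulrC -ltr_pdivrMr//.
  apply: (lt_le_trans (archi_boundP _)); first by rewrite divr_ge0// ltW.
  by rewrite -natrX ler_nat; apply/ltnW/ltn_expl.
apply: SU => k; apply: (adapted_sigma_algebra sS (Sc k)) => x y /gridP xy.
by rewrite /E /mkset /corner xy.
Qed.

End grid.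

(** * Muckenhoupt weights *)

Section weights.
Context (R : realType) (n : nat).
Local Notation T := (euclidean R n).
Local Notation mu := (lebesgue R n).
Implicit Types (o : 'I_n -> R) (L : R) (x y : T) (v : T -> R).

(** The A_1 condition on cells, [L^n] being the volume. Generation 0 suffices: by [grid_shift] every
    generation is the initial one of a finer grid. *)
Definition A1_cells (C : R) v := forall o L x, 0 < L ->
  {ae mu, forall y, cell (grid o L) 0 x y ->
    (\int[mu]_(z in cell (grid o L) 0 x) (v z)%:E <= (C * L ^+ n * v y)%:E)%E}.

Section cells.
Variables (o : 'I_n -> R) (L : R).
Hypothesis L0 : 0 < L.
Local Notation c := (grid o L).

Let l0 k : 0 < L / 2 ^+ k. Proof. by rewrite divr_gt0// exprn_gt0. Qed.

Lemma measurable_grid_cell k x : measurable (cell c k x).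
Proof. by apply: measurable_cell => j i; exact: measurable_grid. Qed.

Lemma integral1_cell k x :
  (\int[mu]_(y in cell c k x) (1 : R)%:E = ((L / 2 ^+ k) ^+ n)%:E)%E.
Proof.
rewrite (integral_cst mu (measurable_grid_cell k x)) mul1e.
exact: lebesgue_cell.
Qed.

Lemma integral1_cell_gt0_lty k x :
  (0 < \int[mu]_(y in cell c k x) (1 : R)%:E < +oo)%E.
Proof. by rewrite integral1_cell lte_fin exprn_gt0// ltry. Qed.

Lemma cell_not_negligible k x (P : T -> Prop) :
  {ae mu, forall y, cell c k x y -> P y} -> exists2 y, cell c k x y & P y.
Proof.
move=> [N [mN N0 PN]]; apply: contrapT => nP.
have : (mu (cell c k x) <= mu N)%E.
  apply: le_measure; rewrite ?inE//; first exact: measurable_grid_cell.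
  by move=> y cy; apply: PN => /= /(_ cy) Py; apply: nP; exists y.
by rewrite N0 [X in (X <= _)%E]lebesgue_cell// leNgt lte_fin exprn_gt0.
Qed.

Lemma integral_cell_gt0 v k x : measurable_fun setT v -> (forall y, 0 < v y) ->
  (0 < \int[mu]_(y in cell c k x) (v y)%:E)%E.
Proof.
move=> mv v0; rewrite lt_neqAle integral_ge0 ?andbT; last first.
  by move=> y _; rewrite lee_fin ltW.
apply/eqP => v_int; have mP := measurable_grid_cell k x.
have : (\int[mu]_(y in cell c k x) `|(v y)%:E| = 0)%E.
  by rewrite v_int; apply: eq_integral => y _; rewrite gee0_abs// lee_fin ltW.
move/(ae_eq_integral_abs mu mP (f := EFin \o v)) => [].
  exact/measurable_EFinP/measurable_funTS.
move=> N HN; have [y _ [vy]] := cell_not_negligible (ex_intro _ N HN).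
by have := v0 y; rewrite vy ltxx.
Qed.

End cells.

Section A1.
Variables (C : R) (v : T -> R).
Hypotheses (C1 : 1 <= C) (mv : measurable_fun setT v) (v0 : forall x, 0 < v x).
Hypothesis vA1 : A1_cells C v.

Lemma A1_cells_ae o L k x : 0 < L ->
  {ae mu, forall y, cell (grid o L) k x y ->
    (\int[mu]_(z in cell (grid o L) k x) (v z)%:E <=
     (C * (L / 2 ^+ k) ^+ n * v y)%:E)%E}.
Proof.
move=> L0; have l0 : 0 < L / 2 ^+ k by rewrite divr_gt0// exprn_gt0.
by have := vA1 o x l0; rewrite /cell -grid_shift.
Qed.

(** The condition bounds the integral by a real number at almost every point of the cell, and a cell
    is not negligible. *)
Lemma A1_cell_lty o L k x : 0 < L ->
  (\int[mu]_(y in cell (grid o L) k x) (v y)%:E < +oo)%E.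
Proof.
move=> L0; have [y _ vy] := cell_not_negligible L0 (A1_cells_ae o k x L0).
by apply: le_lt_trans vy _; exact: ltry.
Qed.

Section grid_average.
Variables (o : 'I_n -> R) (L : R).
Hypothesis L0 : 0 < L.
Local Notation c := (grid o L).
Local Notation A := (average mu c (fun=> 1) v).

Let v_cell := fun k x => A1_cell_lty o k x L0.
Let v0' x : 0 <= v x. Proof. exact: ltW. Qed.
Let mu_cell := integral1_cell_gt0_lty o L0.
Let mc := fun k i => @measurable_grid R n o L k i L0.

Lemma grid_averageE k x :
  ((A k x * (L / 2 ^+ k) ^+ n)%:E = \int[mu]_(y in cell c k x) (v y)%:E)%E.
Proof. by rewrite -(averageE v0' mu_cell v_cell) integral1_cell. Qed.

Let A0 k x : 0 <= A k x. Proof. by apply: average_ge0. Qed.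
Let ln0 k : 0 < (L / 2 ^+ k) ^+ n.
Proof. by rewrite exprn_gt0// divr_gt0// exprn_gt0. Qed.

(** A cell has [2^n] times the volume of each of its children. *)
Lemma grid_average_step k x : A k.+1 x <= 2 ^+ n * A k x.
Proof.
have : (\int[mu]_(y in cell c k.+1 x) (v y)%:E <= \int[mu]_(y in cell c k x) (v
  y)%:E)%E.
  apply: ge0_subset_integral.
  - exact: measurable_cell.
  - exact: measurable_cell.
  - exact/measurable_EFinP/measurable_funTS.
  - by move=> y _; rewrite lee_fin.
  - by apply: cell_sub => // j y z; exact: grid_nested.
rewrite -!grid_averageE lee_fin.
have -> : (L / 2 ^+ k) ^+ n = 2 ^+ n * (L / 2 ^+ k.+1) ^+ n.
  rewrite -exprMn exprS; congr (_ ^+ n); field.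
  by rewrite expf_neq0.
move: (A k x) (A k.+1 x) => a a'.
by rewrite mulrCA mulrA ler_pM2r.
Qed.

(** The bound [A_j <= C v], valid almost everywhere on the larger cell, is integrated over the
    smaller one. *)
Lemma grid_average_A1 j k x : (j <= k)%N -> A j x <= C * A k x.
Proof.
move=> jk; have sub : cell c k x `<=` cell c j x.
  by apply: cell_sub => // i y z; exact: grid_nested.
have mP := measurable_grid_cell o L0 k x.
have : (\int[mu]_(y in cell c k x) (A j x * 1)%:E <=
        \int[mu]_(y in cell c k x) (C * v y)%:E)%E.
  apply: ae_le_integral.
  - by move=> y _; rewrite mulr1 lee_fin.
  - by move=> y _; rewrite lee_fin mulr_ge0//; move: C1; lra.
  apply: filterS (A1_cells_ae o j x L0) => y H /sub/H.
  rewrite -grid_averageE !lee_fin; move: (A j x) => a.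
  by rewrite mulr1 [C * _ * _]mulrAC ler_pM2r.
have C0 : 0 <= C by move: C1; lra.
rewrite !integralZ_real// integral1_cell// -grid_averageE -!EFinM lee_fin.
by move: (A j x) (A k x) => a a'; rewrite mulrA ler_pM2r.
Qed.

Lemma A1_reverse_hoelder (e : R) x : 0 < e < 1 ->
  e * (2 * C - 1) * 2 ^+ n <= 1 ->
  (\int[mu]_(y in cell c 0 x) (v y `^ (1 + e))%:E <=
   (2 * C * A 0%N x `^ (1 + e) * L ^+ n)%:E)%E.
Proof.
move=> e01 eC; rewrite EFinM; have := integral1_cell o L0 0 x.
rewrite expr0 divr1 => <-.
apply: (@reverse_hoelder _ _ _ mu c mc _ _ v mv v0' mu_cell v_cell C (2 ^+ n) e
  x) => //.
- by move=> k y z; exact: grid_nested.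
- by move=> S; exact: grid_generated.
- by rewrite exprn_ege1//; lra.
- exact: grid_average_step.
- by move=> j k y; exact: grid_average_A1.
Qed.

End grid_average.

(** The reverse Hoelder inequality contributes the factor [2 C], and the bound of the average by
    [C v], raised to the power [1 + e], the factor [C^(1+e)]. *)
Lemma A1_cells_powR (e : R) : 0 < e < 1 -> e * (2 * C - 1) * 2 ^+ n <= 1 ->
  A1_cells (2 * C * C `^ (1 + e)) (fun x => v x `^ (1 + e)).
Proof.
move=> e01 eC o L x L0; have e0 : 0 <= 1 + e by case/andP: e01; lra.
have C0 : 0 <= C by move: C1; lra.
have Ln : 0 < L ^+ n by rewrite exprn_gt0.
apply: filterS (A1_cells_ae o 0 x L0) => y H Py.
apply: (le_trans (A1_reverse_hoelder o L0 x e01 eC)); rewrite lee_fin.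
have A0 : 0 <= average mu (grid o L) (fun=> 1) v 0 x.
  by apply: average_ge0 => // z; exact: ltW.
have := H Py; rewrite -grid_averageE// lee_fin expr0 divr1.
move: (average _ _ _ _ _ _) A0 => a a0; rewrite [C * _ * _]mulrAC ler_pM2r// =>
  av.
have : a `^ (1 + e) <= C `^ (1 + e) * v y `^ (1 + e).
  rewrite -(@powRM _ C (v y))//; last exact: ltW.
  by apply: ge0_ler_powR; rewrite ?nnegrE// mulr_ge0// ltW.
have C2 : 0 <= 2 * C by lra.
move: (a `^ (1 + e)) (C `^ (1 + e)) (v y `^ (1 + e)) => a' b r H1.
by have := ler_wpM2r (ltW Ln) (ler_wpM2l C2 H1); lra.
Qed.

End A1.
End weights.

(** Unpacks the A_1 product at a point. If [x = 0] its inverse is [+oo], which forces [a = 0]. *)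
Lemma le_poweR_inve (R : realType) (q K x : R) (a : \bar R) :
  0 < q -> 0 <= K -> 0 <= x -> (0 <= a)%E ->
  (a `^ q^-1 * x%:E^-1 <= K%:E)%E ->
  (a <= (K `^ q * x `^ q)%:E)%E /\ ((0 < a)%E -> 0 < x).
Proof.
move=> q0 K0 x0 a0; have qV : q^-1 != 0 by rewrite invr_eq0 gt_eqF.
move: x0; rewrite le_eqVlt => /orP[/eqP <-|x0].
  rewrite inve0; have [->|an0] := eqVneq a 0%E.
    by rewrite lee_fin mulr_ge0 ?powR_ge0// ltxx.
  have ap : (0 < a `^ q^-1)%E.
    rewrite lt_neqAle poweR_ge0 andbT eq_sym; apply: contra an0 => /eqP.
    by move=> /poweR_eq0_eq0 ->.
  by rewrite gt0_muley// leNgt ltry.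
rewrite inver gt_eqF//; case: a a0 => [r| |]// r0; last first.
  by rewrite poweRyr// gt0_mulye ?lte_fin ?invr_gt0// leNgt ltry.
rewrite poweR_EFin -EFinM !lee_fin => H; split => // .
have {}H : r `^ q^-1 <= K * x by move: H; rewrite ler_pdivrMr.
have -> : r = (r `^ q^-1) `^ q by rewrite -powRrM mulVf ?gt_eqF// powRr1.
rewrite -powRM ?(ltW x0)//; apply: ge0_ler_powR; rewrite ?nnegrE ?powR_ge0//.
  exact: ltW.
by rewrite mulr_ge0// ltW.
Qed.

Section muckenhoupt.
Context (R : realType) (n : nat).
Local Notation T := (euclidean R n).
Local Notation mu := (lebesgue R n).

Lemma measurable_cube (x : T) (r : R) : measurable (cube x r).
Proof.
rewrite (_ : cube x r = \bigcap_(i in [set: 'I_n])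
    ((fun y : T => tnth y i) @^-1` [set` `[(tnth x i : R) - r, (tnth x i :
      R) + r]])).
  apply: fin_bigcap_measurable => // i _.
  by rewrite -[X in measurable X]setTI; exact: measurable_tnth.
apply/seteqP; split => y.
  by move=> cy i _; rewrite /= in_itv/= -ler_distl.
by move=> cy i; have := cy i Logic.I; rewrite /= in_itv/= -ler_distl.
Qed.

(** Almost everywhere on the cube [1 / w] is at most its essential supremum. The second conclusion
    prepares the dichotomy between null and positive weights. *)
Lemma muckenhoupt_A1_ae (q : R) (w : T -> R) : 0 < q -> (forall x, 0 <= w x) ->
  muckenhoupt_A1 q w -> exists2 K : R, 0 <= K & forall x r, 0 < r ->
    {ae mu, forall y, cube x r y ->
      (\int[mu]_(z in cube x r) (w z `^ q)%:E <=
         (K * (2 * r) ^+ n * w y `^ q)%:E)%E /\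
      ((0 < \int[mu]_(z in cube x r) (w z `^ q)%:E)%E -> 0 < w y)}.
Proof.
move=> q0 w0; rewrite /muckenhoupt_A1; set S := (X in ereal_sup X) => supS.
have [K K0 KS] : exists2 K : R, 0 <= K & forall s, S s -> (s <= K%:E)%E.
  exists (Num.max 0 (fine (ereal_sup S))); first by rewrite le_max lexx.
  move=> s Ss; have := ereal_sup_ubound Ss; move: (ereal_sup S) supS =>
    [b _|//|_] /=.
    by move=> /le_trans; apply; rewrite lee_fin le_max lexx orbT.
  by move=> /le_trans; apply; rewrite leNye.
exists (K `^ q); first exact: powR_ge0.
move=> x r r0; have rn : 0 < (2 * r) ^+ n by rewrite exprn_gt0// mulr_gt0.
set I := (\int[mu]_(z in cube x r) (w z `^ q)%:E)%E.
have KQ : (((mu (cube x r))^-1 * I) `^ q^-1 * ess_sup_inv w (cube x r) <=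
  K%:E)%E.
  by apply: KS; exists (cube x r) => //; exists x, r.
have I0 : (0 <= I)%E by apply: integral_ge0 => z _; rewrite lee_fin powR_ge0.
have muQ : ((mu (cube x r))^-1)%E = (((2 * r) ^+ n)^-1)%:E.
  have -> : mu (cube x r) = ((2 * r) ^+ n)%:E by exact: lebesgue_cube.
  by rewrite inver gt_eqF.
rewrite muQ in KQ.
have rV : (0 < (((2 * r) ^+ n)^-1)%:E)%E by rewrite lte_fin invr_gt0.
have a0 : (0 <= (((2 * r) ^+ n)^-1)%:E * I)%E by apply: mule_ge0 => //; exact:
  ltW.
apply: filterS (ess_sup_ge mu ((fun z => (w z)%:E^-1%E) \_ (cube x r))) =>
  y wy Qy.
have wyS : ((w y)%:E^-1 <= ess_sup_inv w (cube x r))%E.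
  by move: wy; rewrite /ess_sup_inv patchE mem_set.
have := le_trans (lee_wpmul2l (poweR_ge0 _ _) wyS) KQ.
move=> /(le_poweR_inve q0 K0 (w0 y) a0)[Ia pos]; split; last first.
  by move=> Ip; apply: pos; exact: mule_gt0.
have := lee_wpmul2l (ltW (_ : 0 < ((2 * r) ^+ n)%:E)%E) Ia.
rewrite lte_fin => /(_ rn); rewrite muleA -EFinM mulfV ?gt_eqF// mul1e.
by rewrite -EFinM mulrCA mulrA.
Qed.

Lemma cube_exhaustion (x : T) : \bigcup_m cube x m.+1%:R = setT.
Proof.
apply/seteqP; split => // y _.
pose b := \sum_i `|(tnth y i : R) - tnth x i|.
exists (Num.bound b) => //= i; apply: (@le_trans _ _ b).
  by rewrite /b (bigD1 i)//= lerDl sumr_ge0.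
have : b < (Num.bound b)%:R by apply: archi_boundP; exact: sumr_ge0.
by move=> /ltW/le_trans; apply; rewrite ler_nat.
Qed.

(** Once [w^q] has positive integral over one cube, it does so over all larger ones, and [w] is
    positive almost everywhere on each of them. The weight is then replaced by a Borel
    representative that is positive everywhere. *)
Lemma muckenhoupt_A1_cells (q : R) (w : T -> R) : 0 < q ->
  (forall x, 0 <= w x) -> lebesgue_measurable w -> muckenhoupt_A1 q w ->
  {ae mu, forall x, w x = 0} \/
  exists v : T -> R, [/\ measurable_fun setT v, forall x, 0 < v x,
    {ae mu, forall x, w x = v x} &
    exists2 C : R, 1 <= C & A1_cells C (fun x => v x `^ q)].
Proof.
move=> q0 w0 [h mh wh] /(muckenhoupt_A1_ae q0 w0)[K K0 wA1].
have wq0 z : (0 <= (w z `^ q)%:E)%E by rewrite lee_fin powR_ge0.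
have cubeT (x : T) (P : T -> Prop) :
    (forall m : nat, {ae mu, forall y, cube x m.+1%:R y -> P y}) -> {ae mu,
      forall y, P y}.
  move=> H; have : mu.-negligible (\bigcup_m ~` [set y | cube x m.+1%:R y ->
    P y]).
    exact: negligible_bigcup.
  apply: negligibleS => y nP.
  have : (\bigcup_m cube x m.+1%:R) y by rewrite cube_exhaustion.
  by move=> [m _ cy]; exists m => //= /(_ cy).
have [[x [r [r0 wI]]]|nw] := pselect (exists x r, 0 < r /\
    (0 < \int[mu]_(z in cube x r) (w z `^ q)%:E)%E); last first.
  left; apply: (cubeT [tuple (0 : measurableTypeR R) | i < n]) => m.
  set Q := cube _ _.
  have mQ : measurable Q by exact: measurable_cube.
  have I0 : (\int[mu]_(z in Q) (w z `^ q)%:E = 0)%E.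
    apply/eqP; rewrite eq_le integral_ge0 ?andbT//.
    rewrite leNgt; apply/negP => I0; apply: nw.
    by exists [tuple (0 : measurableTypeR R) | i < n], m.+1%:R; rewrite ltr0n.
  have : (\int[mu]_(z in Q) `|(h z `^ q)%:E| = 0)%E.
    rewrite -I0; apply: ae_eq_ge0_integral => //.
    by apply: filterS wh => z wz _; rewrite gee0_abs ?lee_fin ?powR_ge0// wz.
  have mhq : measurable_fun setT (fun z => h z `^ q) by exact:
    measurable_fun_powR.
  move/(ae_eq_integral_abs mu mQ (f := fun z => (h z `^ q)%:E)) => [].
    exact/measurable_EFinP/measurable_funTS.
  move=> N HN; apply: filterS2 wh (ex_intro _ N HN) => z wz hz Qz.
  by rewrite wz; have [] := hz Qz; exact: powR_eq0_eq0.
(* The default value 1 is taken on a null set only. *)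
right; pose v z := if 0 < h z then h z else 1.
have wpos : {ae mu, forall z, 0 < w z}.
  apply: (cubeT x) => m.
  (* This radius covers both the cube of positive integral and the m-th cube of the exhaustion. *)
  have rm : 0 < r + m.+1%:R by rewrite addr_gt0// ltr0n.
  apply: filterS (wA1 x _ rm) => z H Qz.
  have sub s : 0 <= s -> cube x s `<=` cube x (s + m.+1%:R) => //.
    by move=> s0 y cy i; rewrite (le_trans (cy i))// lerDl ler0n.
  have [|_] := H.
    by move=> i; apply: (le_trans (Qz i)); rewrite lerDr ltW.
  apply; apply: (lt_le_trans wI).
  rewrite integral_mkcond [leRHS]integral_mkcond.
  apply: ae_le_integral => //.
  - by move=> y _; apply: erestrict_ge0.
  - by move=> y _; apply: erestrict_ge0.
  - apply: nearW => y _; rewrite !patchE; case: ifPn => [/set_mem Qy|_].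
      by rewrite mem_set//; apply: sub => //; exact: ltW.
    by case: ifPn.
have v0 z : 0 < v z by rewrite /v; case: ifPn.
have mv : measurable_fun setT v.
  apply: measurable_fun_ifT => //.
  exact: measurable_fun_ltr.
have wv : {ae mu, forall z, w z = v z}.
  by apply: filterS2 wh wpos => z wz; rewrite /v -wz => ->.
exists v; split => //; exists (Num.max 1 K); first by rewrite le_max lexx.
move=> o L y L0.
have [y' sub] := cell_sub_cube o 0 y L0; rewrite expr0 divr1 in sub.
have wv' := wv; have L2 : 0 < L / 2 by rewrite divr_gt0.
apply: filterS2 wv (wA1 y' _ L2) => z wz H Pz; have [+ _] := H (sub _ Pz).
rewrite (mulrC 2) divfK// wz => Hz; apply: (@le_trans _ _ (K * L ^+ n * v z `^
  q)%:E).
  apply: le_trans Hz.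
  rewrite integral_mkcond [leRHS]integral_mkcond.
  apply: ae_le_integral => //.
  - by move=> t _; apply: erestrict_ge0 => ? _; rewrite lee_fin powR_ge0.
  - by move=> t _; apply: erestrict_ge0.
  - apply: filterS wv' => t wt _; rewrite !patchE; case: ifPn =>
    [/set_mem Pt|_].
      by rewrite mem_set ?wt//; exact: sub.
    by case: ifPn.
rewrite lee_fin -!mulrA; apply: ler_wpM2r; last by rewrite le_max lexx orbT.
by rewrite mulr_ge0 ?powR_ge0// exprn_ge0// ltW.
Qed.

End muckenhoupt.

(** * Shifted grids *)

Section one_third.
Context (R : realType).

Lemma floor_jump (z e : R) : 0 <= e ->
  (forall z', `|z' - z| <= e -> Num.floor z' = Num.floor z) \/
  (exists m : int, z - e <= m%:~R <= z + e).
Proof.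
move=> e0; have [ze|ze] := eqVneq (Num.floor (z - e)) (Num.floor (z + e)).
  left=> z'; rewrite ler_distl => /andP[z1 z2].
  have H (t : R) : z - e <= t -> t <= z + e -> Num.floor t = Num.floor (z - e).
    by move=> t1 t2; apply/eqP; rewrite eq_le {1}ze !le_floor.
  by rewrite !H//; lra.
right; exists (Num.floor (z + e)); rewrite floor_le andbT.
rewrite leNgt; apply/negP => h; move/eqP: ze; apply; apply/eqP.
by rewrite eq_le le_floor /=; [rewrite floor_ge_int ltW|lra].
Qed.

(* The breakpoints of the dyadic grid of mesh 1 and of its translate by
   [2^k / 3] are at distance at least 1/3 from each other. *)
Lemma floor_one_third (z e : R) (k : nat) : 0 <= e -> 6 * e < 1 ->
  exists b : bool, forall z', `|z' - z| <= e ->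
    Num.floor (z' - b%:R * (2 ^+ k / 3)) = Num.floor (z - b%:R * (2 ^+ k / 3)).
Proof.
move=> e0 e6; have [H|[m /andP[m1 m2]]] := floor_jump z e0.
  by exists false => z'; rewrite mul0r !subr0; exact: H.
have [H|[m' /andP[m1' m2']]] := floor_jump (z - 2 ^+ k / 3) e0.
  exists true => z' z'z; rewrite mul1r; apply: H.
  by rewrite opprB addrA subrK.
(* If both grids had a breakpoint within [e], this integer would be at most [6 e] in absolute value,
   hence 0, and 3 would divide [2^k]. *)
have H : `|(3 * (m - m') - 2 ^+ k)%:~R : R| < 1.
  by rewrite ltr_norml !(intrB, intrM, rmorphXn)/=; apply/andP; split; lra.
have /(congr1 absz) : 3 * (m - m') = 2 ^+ k.
  apply/eqP; rewrite -subr_eq0 -normr_le0; move: H.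
  by rewrite -intr_norm -[1]/(1%:~R : R) ltr_int -ltzD1.
rewrite abszM abszX /= => mk; have : (3 %| 2 ^ k)%N by rewrite -mk dvdn_mulr.
by rewrite Euclid_dvdX// => /andP[].
Qed.

Variable n : nat.
Local Notation T := (euclidean R n).

(** In units of the mesh of generation [k], a third of [L] is [2^k / 3], so one shift serves all
    generations. *)
Definition shift (L : R) (s : {ffun 'I_n -> bool}) (i : 'I_n) : R :=
  (s i)%:R * (L / 3).

Lemma cube_sub_shifted_cell (x : T) (r L : R) (k : nat) : 0 < L -> 0 < r ->
  6 * r < L / 2 ^+ k ->
  exists s, cube x r `<=` cell (grid (shift L s) L) k x.
Proof.
move=> L0 r0 rL; set l := L / 2 ^+ k in rL.
have k0 : 0 < 2 ^+ k :> R by rewrite exprn_gt0.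
have l0 : 0 < l by rewrite divr_gt0.
have rl0 : 0 <= r / l by rewrite divr_ge0// ltW.
have rl6 : 6 * (r / l) < 1 by rewrite mulrA ltr_pdivrMr// mul1r.
have /choice[s sP] : forall i : 'I_n, exists b : bool, forall z',
    `|z' - (tnth x i : R) / l| <= r / l ->
    Num.floor (z' - b%:R * (2 ^+ k / 3)) =
    Num.floor ((tnth x i : R) / l - b%:R * (2 ^+ k / 3)).
  by move=> i; exact: floor_one_third.
exists [ffun i => s i] => y cy; apply/gridP => i; rewrite /shift ffunE.
have E (t : R) : 2 ^+ k * ((t - (s i)%:R * (L / 3)) / L) =
    t / l - (s i)%:R * (2 ^+ k / 3).
  rewrite /l; field; rewrite ?gt_eqF//.
rewrite !E; apply: sP.
by rewrite -mulrBl normrM (gtr0_norm (_ : 0 < l^-1)) ?invr_gt0// ler_pM2r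
  ?invr_gt0.
Qed.

(** Generations 0 to [2 N] of the grid of mesh [2^N] have meshes from [2^N] down to [2^-N]; for
    large [N] one of them lies between [6 r] and [12 r]. *)
Lemma dyadic_scale (r : R) : 0 < r -> exists N0, forall N, (N0 <= N)%N ->
  exists k, [/\ (k <= N + N)%N, 6 * r < 2 ^+ N / 2 ^+ k & 2 ^+ N / 2 ^+ k <= 12
    * r].
Proof.
move=> r0; pose a := 6 * r; have a0 : 0 < a by rewrite /a; lra.
exists (Num.bound (a + a^-1)) => N N0.
have aN : a + a^-1 < 2 ^+ N.
  apply: (lt_le_trans (archi_boundP _)); first by rewrite addr_ge0// ?invr_ge0
    ltW.
  rewrite -natrX ler_nat; apply: (leq_trans N0); exact/ltnW/ltn_expl.
have aV : 0 < a^-1 by rewrite invr_gt0.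
have N2 : 0 < 2 ^+ N :> R by rewrite exprn_gt0.
have : exists j, 2 ^+ N <= 2 ^+ j * a.
  exists (N + N)%N; rewrite exprD -mulrA ler_pMr// -ler_pdivrMr// mul1r; lra.
(* The least [j] with [2^N <= 2^j a] is positive since [a < 2^N]; its predecessor is the generation
   sought. *)
move=> /ex_minnP[[|k]]; first by rewrite expr0 mul1r; lra.
move=> kP kmin; exists k.
have k0 : 0 < 2 ^+ k :> R by rewrite exprn_gt0.
have ka : 2 ^+ k * a < 2 ^+ N.
  by rewrite ltNge; apply/negP => /kmin; rewrite ltnn.
split.
- have : (k < N + N)%N; last exact: ltnW.
  rewrite -(@ltr_eXn2l R 2)//; last by lra.
  have : 2 ^+ k < 2 ^+ N / a by rewrite ltr_pdivlMr.
  move=> /lt_le_trans; apply; rewrite exprD ler_pM2l//; lra.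
- by rewrite ltr_pdivlMr// mulrC.
- by rewrite ler_pdivrMr//; move: kP; rewrite exprS /a; lra.
Qed.

End one_third.

(** * Strong type estimate *)

Section cell_powers.
Context (R : realType).
Implicit Types A S C b l th p q : R.

(** The relation between the exponents splits [A^q S^(q th)] into [(A^p S)^(q th)] and [A^p]; the
    first factor is at most [b^(q th)]. *)
Lemma le_cell_power A S C b th p q : 0 < q -> q = p + p * (q * th) ->
  0 <= th -> 0 <= A -> 0 <= S -> 0 <= C -> A `^ p * S <= b ->
  (C `^ (1 - th) * S `^ th * A) `^ q <=
  C `^ ((1 - th) * q) * b `^ (q * th) * A `^ p.
Proof.
move=> q0 pqE th0 A0 S0 C0 ASb.
have Ap0 : 0 <= A `^ p * S by rewrite mulr_ge0// powR_ge0.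
have -> : (C `^ (1 - th) * S `^ th * A) `^ q =
    C `^ ((1 - th) * q) * (A `^ p * S) `^ (q * th) * A `^ p.
  rewrite !powRM ?powR_ge0//; last by rewrite mulr_ge0// powR_ge0.
  rewrite -!powRrM [X in A `^ X]pqE powRD; last by rewrite -pqE gt_eqF.
  by rewrite (mulrC th q); lra.
apply: ler_wpM2r; first exact: powR_ge0.
apply: ler_wpM2l; first exact: powR_ge0.
apply: ge0_ler_powR; rewrite ?nnegrE//; first by rewrite mulr_ge0// ltW.
exact: le_trans ASb.
Qed.

Lemma cell_power_eq A S C l th : 0 < S -> 0 < C -> 0 < l ->
  (S / (C * l)) `^ (th - 1) * (A * S) = l `^ (1 - th) * (C `^ (1 - th) * S `^
    th * A).
Proof.
move=> S0 C0 l0.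
rewrite powRM ?invr_ge0 ?mulr_ge0 ?(ltW S0) ?(ltW C0) ?(ltW l0)//.
rewrite -powR_inv1 ?mulr_ge0 ?(ltW C0) ?(ltW l0)// -powRrM mulN1r opprB.
have e : S `^ th = S `^ (th - 1) * S.
  rewrite -[X in _ * X](powRr1 (ltW S0)) -powRD ?subrK//.
  by apply/implyP => _; rewrite gt_eqF.
by rewrite powRM ?(ltW C0) ?(ltW l0)// e; lra.
Qed.

End cell_powers.

Lemma fractional_maximal_ge0 (R : realType) n (alpha : R) (f : euclidean R n ->
  R) x :
  (0 <= fractional_maximal alpha f x)%E.
Proof.
apply: (@le_trans _ _ (lebesgue R n (cube x 1) `^ (-1 + alpha / n%:R) *
    \int[lebesgue R n]_(y in cube x 1) `|f y|%:E)%E).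
  by apply: mule_ge0; [exact: poweR_ge0|exact: integral_ge0].
by apply: ereal_sup_ubound; exists 1 => //=; exact: ltr01.
Qed.

Lemma ae_eq_fractional_maximal (R : realType) n (alpha : R) (f g :
  euclidean R n -> R) :
  {ae lebesgue R n, forall x, f x = g x} ->
  fractional_maximal alpha f = fractional_maximal alpha g.
Proof.
move=> fg; apply/funext => x; rewrite /fractional_maximal; congr ereal_sup.
apply: eq_imagel => r _; congr (_ * _)%E; apply: ae_eq_ge0_integral => //.
by apply: filterS fg => y fgy _; rewrite fgy.
Qed.

(** * The estimate for a positive Borel weight *)

Section strong_type.
Context (R : realType) (n : nat).
Local Notation T := (euclidean R n).
Local Notation mu := (lebesgue R n).
Variables (th p q C : R) (w f : T -> R).
Hypotheses (th01 : 0 < th < 1) (p1 : 1 < p) (q0 : 0 < q) (C1 : 1 <= C).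
Hypothesis pq : q^-1 = p^-1 - th.
Hypotheses (mw : measurable_fun setT w) (w0 : forall x, 0 < w x).
Hypothesis vA1 : A1_cells C (fun x => w x `^ q).
Hypothesis mf : measurable_fun setT f.
Hypothesis fp : (\int[mu]_x ((`|f x| * w x) `^ p)%:E < +oo)%E.

Let v x : R := w x `^ q.
Let G x : R := `|f x| * w x `^ (1 - q / p).
Let b := fine (\int[mu]_x ((`|f x| * w x) `^ p)%:E)%E.

Let v0 x : 0 < v x. Proof. exact: powR_gt0. Qed.
Let v0' x : 0 <= v x. Proof. exact/ltW. Qed.
Let G0 x : 0 <= G x. Proof. by rewrite mulr_ge0// powR_ge0. Qed.
Let mv : measurable_fun setT v. Proof. exact: measurable_fun_powR. Qed.
Let mnf : measurable_fun setT (fun x => `|f x|).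
Proof. exact: measurableT_comp. Qed.
Let mG : measurable_fun setT G.
Proof. by apply: measurable_funM => //; exact: measurable_fun_powR. Qed.
Let p0 : 0 < p. Proof. by move: p1; lra. Qed.

Let pqE : q = p + p * (q * th).
Proof.
have e : th = p^-1 - q^-1 by move: pq; lra.
by rewrite e; field; rewrite !gt_eqF.
Qed.

Let GpE x : G x `^ p * v x = (`|f x| * w x) `^ p.
Proof.
have e : (1 - q / p) * p + q = p by field; rewrite gt_eqF.
rewrite /G !powRM ?powR_ge0//; last exact: ltW.
by rewrite -powRrM -mulrA -powRD ?gt_eqF// ?implybT// e.
Qed.

Let GvE x : `|f x| = v x `^ (th - 1) * (G x * v x).
Proof.
have wn x' : w x' != 0 by rewrite gt_eqF.
rewrite /G /v -powRrM -mulrA -powRD ?wn ?implybT// mulrCA -powRD ?wn ?implybT//.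
rewrite (_ : _ + _ = 0) ?powRr0 ?mulr1//.
have e : th = p^-1 - q^-1 by move: pq; lra.
by rewrite e; field; rewrite !gt_eqF.
Qed.

Let Gp_lty : (\int[mu]_x (G x `^ p * v x)%:E < +oo)%E.
Proof. by under eq_integral do rewrite GpE. Qed.

Let bE : (b%:E = \int[mu]_x (G x `^ p * v x)%:E)%E.
Proof.
under eq_integral do rewrite GpE.
by rewrite fineK// ge0_fin_numE//; apply: integral_ge0 => x _;
  rewrite lee_fin powR_ge0.
Qed.

Let b0 : 0 <= b.
Proof. by apply: fine_ge0; apply: integral_ge0 => x _;
  rewrite lee_fin powR_ge0. Qed.

Section cell_estimate.
Variables (o : 'I_n -> R) (L : R).
Hypothesis L0 : 0 < L.
Local Notation c := (grid o L).

Let v_cell k x : (0 < \int[mu]_(y in cell c k x) (v y)%:E < +oo)%E.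
Proof.
apply/andP; split; first exact: integral_cell_gt0.
exact: (A1_cell_lty vA1 o k x L0).
Qed.

Let mc k i : measurable (c k @^-1` [set i]). Proof. exact: measurable_grid. Qed.
Let gv_cell k x : (\int[mu]_(y in cell c k x) (G y * v y)%:E < +oo)%E.
Proof. exact: (average_weight_lty mc p1 mv mG v0' G0 v_cell Gp_lty). Qed.

Let Gv0 x : 0 <= G x * v x. Proof. by rewrite mulr_ge0. Qed.

(** With [S] the integral of [v], A_1 gives [v >= S / (C |P|)] on the cell. As [th - 1] is negative,
    this bounds [|f| = v^(th-1) G v] from above; Jensen's inequality yields [A^p S <= b]. *)
Lemma cell_estimate k x : exists D : R, [/\ 0 <= D,
  (\int[mu]_(y in cell c k x) `|f y|%:E <=
     (((L / 2 ^+ k) ^+ n) `^ (1 - th) * D)%:E)%E &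
  D `^ q <= C `^ ((1 - th) * q) * b `^ (q * th) *
            average mu c v (fun y => G y * v y) k x `^ p].
Proof.
have [th0 th1] := andP th01.
have C0 : 0 < C by move: C1; lra.
set A := average _ _ _ _ _ _; have A0 : 0 <= A by exact: average_ge0.
set ln := (L / 2 ^+ k) ^+ n.
have ln0 : 0 < ln by rewrite exprn_gt0// divr_gt0// exprn_gt0.
have /andP[S0 Soo] := v_cell k x.
pose S := fine (\int[mu]_(y in cell c k x) (v y)%:E)%E.
have SE : (S%:E = \int[mu]_(y in cell c k x) (v y)%:E)%E.
  by rewrite fineK// ge0_fin_numE// ltW.
have {}S0 : 0 < S by rewrite -lte_fin SE.
have Spow s : 0 <= S `^ s by exact: powR_ge0.
have AS : ((A * S)%:E = \int[mu]_(y in cell c k x) (G y * v y)%:E)%E.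
  by rewrite EFinM SE; exact: (averageE Gv0 v_cell gv_cell).
have ASb : A `^ p * S <= b.
  rewrite -lee_fin EFinM SE bE.
  apply: (le_trans (jensen_average mc p1 mv mG v0' G0 v_cell Gp_lty k x)).
  apply: ge0_subset_integral => //; first exact: measurable_cell.
    apply/measurable_EFinP; apply: measurable_funM => //.
    exact: measurable_fun_powR.
  by move=> y _; rewrite lee_fin mulr_ge0// powR_ge0.
clearbody A.
exists (C `^ (1 - th) * S `^ th * A); split; last first.
- exact: (le_cell_power q0 pqE (ltW th0) A0 (ltW S0) (ltW C0) ASb).
- pose a := S / (C * ln).
have a0 : 0 < a by rewrite divr_gt0// mulr_gt0.
apply: (@le_trans _ _ (\int[mu]_(y in cell c k x) (a `^ (th - 1) * (G y * v
  y))%:E)%E).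
  apply: ae_le_integral.
  - by move=> y _; rewrite lee_fin.
  - by move=> y _; rewrite lee_fin mulr_ge0// powR_ge0.
  apply: filterS (A1_cells_ae vA1 o k x L0) => y H /H.
  rewrite -SE !lee_fin -/ln => Sv; rewrite GvE; apply: ler_wpM2r => //.
  have av : a <= v y by rewrite ler_pdivrMr ?mulr_gt0// mulrC.
  rewrite -opprB !powRN lef_pV2 ?posrE ?powR_gt0//.
  by apply: ge0_ler_powR; rewrite ?nnegrE// ?subr_ge0 ltW.
rewrite integralZ_real ?powR_ge0//; last 2 first.
- exact: measurable_cell.
- exact: measurable_funM.
rewrite -AS -EFinM lee_fin le_eqVlt; apply/orP; left; apply/eqP.
exact: (cell_power_eq _ _ S0 C0 ln0).
- by rewrite mulr_ge0// mulr_ge0// powR_ge0.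
Qed.

Lemma measurable_running_average k :
  measurable_fun setT (running_max (average mu c v (fun y => G y * v y)) k).
Proof.
apply: (measurable_adapted mc (k := k)); apply: adapted_running_max.
  by move=> j x y; exact: grid_nested.
by move=> j; exact: adapted_average.
Qed.

Lemma doob_grid k :
  (\int[mu]_x (running_max (average mu c v (fun y =>
    G y * v y)) k x `^ p * v x)%:E
     <= (2 `^ p / (p - 1) * b)%:E)%E.
Proof.
rewrite EFinM bE; apply: (doob mc _ p1 mv mG v0' G0 v_cell Gp_lty).
by move=> j x y; exact: grid_nested.
Qed.

End cell_estimate.

Let M N (s : {ffun 'I_n -> bool}) : T -> R :=
  let c := grid (shift (2 ^+ N) s) (2 ^+ N) in
  running_max (average mu c v (fun y => G y * v y)) (N + N).

(** A sum over all shifts, because the suitable shift depends on the cube. *)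
Let W N x := \sum_(s : {ffun 'I_n -> bool}) M N s x `^ p.

(** The cell has side at most [12 r], six times that of the cube it contains. *)
Let six := (6 ^+ n : R) `^ (1 - th).
Let K0 := six `^ q * (C `^ ((1 - th) * q) * b `^ (q * th)).

Let M0 N s x : 0 <= M N s x.
Proof. by apply: running_max_ge0 => j; apply: average_ge0 => // y;
  rewrite mulr_ge0. Qed.

Let W0 N x : 0 <= W N x.
Proof. by apply: sumr_ge0 => s _; exact: powR_ge0. Qed.

Let K0_ge0 : 0 <= K0. Proof. by rewrite !mulr_ge0// powR_ge0. Qed.

Let n0 N : 0 < 2 ^+ N :> R. Proof. exact: exprn_gt0. Qed.

Lemma cube_estimate x r : 0 < r -> exists N0, forall N, (N0 <= N)%N ->
  exists D : R, [/\ 0 <= D,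
    ((((2 * r) ^+ n) `^ (th - 1))%:E * \int[mu]_(y in cube x r) `|f y|%:E <=
      D%:E)%E &
    D `^ q <= K0 * W N x].
Proof.
move=> r0; have [N0 N0P] := dyadic_scale r0; exists N0 => N /N0P[k [kN rl lr]].
have [s sub] := cube_sub_shifted_cell x (n0 N) r0 rl.
have [D [D0 fD Dq]] := cell_estimate (shift (2 ^+ N) s) (n0 N) k x.
have [th0 th1] := andP th01.
have six0 : 0 <= six by exact: powR_ge0.
have r20 : 0 < (2 * r) ^+ n by rewrite exprn_gt0// mulr_gt0.
exists (six * D); split; first exact: mulr_ge0.
  set l : R := 2 ^+ N / 2 ^+ k in lr fD.
  have l0 : 0 < l by rewrite divr_gt0.
  have le_int : (\int[mu]_(y in cube x r) `|f y|%:E <= (((l ^+ n) `^ (1 -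
    th))%R * D)%:E)%E.
    apply: le_trans fD; apply: ge0_subset_integral => //.
    - exact: measurable_cube.
    - exact: measurable_grid_cell.
    - exact/measurable_EFinP/measurable_funTS.
  apply: (le_trans (lee_wpmul2l _ le_int)); first by rewrite lee_fin powR_ge0.
  rewrite -EFinM lee_fin mulrA; apply: ler_wpM2r => //.
  rewrite -opprB powRN mulrC ler_pdivrMr ?powR_gt0// /six -powRM ?exprn_ge0//
    ?mulr_ge0 ?(ltW r0)//.
  apply: ge0_ler_powR; rewrite ?nnegrE ?subr_ge0 ?mulr_ge0 ?exprn_ge0 ?mulr_ge0
    ?(ltW r0) ?(ltW l0) ?(ltW th1)//.
  rewrite -exprMn lerXn2r ?nnegrE ?mulr_ge0 ?(ltW r0) ?(ltW l0)//; lra.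
rewrite powRM// /K0 -mulrA; apply: ler_wpM2l; first exact: powR_ge0.
apply: (le_trans Dq); apply: ler_wpM2l; first by rewrite mulr_ge0// powR_ge0.
apply: (@le_trans _ _ (M N s x `^ p)).
  apply: ge0_ler_powR; rewrite ?nnegrE ?(ltW p0)//; last exact: running_max_ge.
  by apply: average_ge0 => // y; rewrite mulr_ge0.
by rewrite /W (bigD1 s)//= lerDl sumr_ge0// => ? _; exact: powR_ge0.
Qed.

(** A real below the integrand is already exceeded through a single cube, hence is at most [u N x]
    for all large [N]. Fatou's lemma then reduces the claim to Doob's inequality for each shift. *)
Lemma strong_type (alpha : R) : th = alpha / n%:R ->
  (\int[mu]_x (fractional_maximal alpha f x * (w x)%:E) `^ q <=
   (K0 * (#|{ffun 'I_n -> bool}|%:R * (2 `^ p / (p - 1) * b)))%:E)%E.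
Proof.
move=> thE; pose u N x := K0 * (W N x * v x).
have mM N s : measurable_fun setT (M N s) by exact: measurable_running_average.
have mMv N s : measurable_fun setT (fun x => M N s x `^ p * v x).
  by apply: measurable_funM => //; exact: measurable_fun_powR.
have Mv0 N s x : 0 <= M N s x `^ p * v x by rewrite mulr_ge0// powR_ge0.
have uE N : W N = fun x => \sum_(s : {ffun 'I_n -> bool}) M N s x `^ p by [].
have mW N : measurable_fun setT (W N).
  rewrite uE; apply: measurable_sum => s; exact: measurable_fun_powR.
have valueE x r : 0 < r ->
    ((mu (cube x r) `^ (-1 + alpha / n%:R))%E = (((2 * r) ^+ n) `^ (th -
      1))%:E)%E.
  move=> r0; have -> : mu (cube x r) = ((2 * r) ^+ n)%:E by exact:
    lebesgue_cube.
  by rewrite poweR_EFin -thE addrC.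
apply: (@fatou_bound _ _ _ mu u).
- by move=> N; apply: measurable_funM => //; exact: measurable_funM.
- by move=> N x; rewrite mulr_ge0// mulr_ge0.
- by move=> x; exact: poweR_ge0.
- apply: nearW => x rho; have [rho0 _|rho0 lt_rho] := ltP rho 0.
    by apply: nearW => N; rewrite (le_trans (ltW rho0))// mulr_ge0// mulr_ge0.
  have qV : q^-1 * q = 1 by rewrite mulVf// gt_eqF.
  (* The level that the maximal function exceeds at [x], as [(t w)^q = rho]. *)
  pose t := rho `^ q^-1 / w x.
  have t0 : 0 <= t by rewrite divr_ge0 ?powR_ge0// ltW.
  have tE : (t * w x) `^ q = rho by rewrite divfK ?gt_eqF// -powRrM qV powRr1.
  have [r r0 tr] : exists2 r, 0 < r &
      (t%:E < (((2 * r) ^+ n) `^ (th - 1))%:E * \int[mu]_(y in cube x r) `|f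
        y|%:E)%E.
    apply: contrapT => nr; move: lt_rho; apply/negP;
      rewrite -leNgt -tE -poweR_EFin.
    have H : (fractional_maximal alpha f x <= t%:E)%E.
      apply: ge_ereal_sup => _ [r /= r0 <-]; rewrite valueE// leNgt;
        apply/negP => tr.
      by apply: nr; exists r.
    have F0 := fractional_maximal_ge0 alpha f x.
    rewrite EFinM; apply: gt0_ler_poweR; rewrite ?in_itv/= ?leey ?andbT ?(ltW
      q0)//.
    + by rewrite mule_ge0// lee_fin ltW.
    + by rewrite mule_ge0// lee_fin ltW.
    + by apply: lee_wpmul2r => //; rewrite lee_fin ltW.
  have [N0 N0P] := cube_estimate x r0; exists N0 => // N /= /N0P[D [D0 fD Dq]].
  have tD : t <= D by rewrite -lee_fin; apply/ltW/(lt_le_trans tr).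
  rewrite -tE powRM ?(ltW (w0 x))// -/(v x) /u mulrA; apply: ler_wpM2r => //.
  by apply: le_trans Dq; apply: ge0_ler_powR; rewrite ?nnegrE// ltW.
- move=> N; rewrite integralZ_real//; last 2 first.
  + exact: measurable_funM.
  + by move=> x; rewrite mulr_ge0.
  rewrite [leRHS]EFinM; apply: lee_wpmul2l; first by rewrite lee_fin.
  rewrite (_ : (\int[mu]_x (W N x * v x)%:E)%E =
    (\int[mu]_x \sum_(s <- enum {: {ffun 'I_n ->
      bool}}) (M N s x `^ p * v x)%:E)%E); last first.
    apply: eq_integral => x _; rewrite sumEFin big_enum /= /W mulr_suml.
    by [].
  rewrite ge0_integral_sum//; last 2 first.
  + by move=> s; exact/measurable_EFinP.
  + by move=> s x _; rewrite lee_fin.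
  apply: (@le_trans _ _ (\sum_(s <- enum {: {ffun 'I_n ->
    bool}}) (2 `^ p / (p - 1) * b)%:E)%E).
    by apply: lee_sum => s _; exact: doob_grid.
  by rewrite sumEFin big_enum /= sumr_const mulr_natl.
Qed.
End strong_type.

(** * Exponents, passage to representatives and conclusion *)

(** The reciprocals are affine in [t], and [1/p - 1/q] equals [th] at both endpoints. As [t < 1],
    the endpoint [q0] is excluded. *)
Lemma exponent_relations (R : realFieldType) (th q0 q1 p1 p q t : R) :
  0 < th -> 1 < q0 -> 1 / q0 = 1 - th -> q0 < q1 -> 1 / q1 = 1 / p1 - th ->
  0 <= t < 1 -> 1 / p = t + (1 - t) / p1 -> 1 / q = t / q0 + (1 - t) / q1 ->
  [/\ 1 < p, q0 < q, q <= q1 & q^-1 = p^-1 - th].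
Proof.
rewrite !div1r => th0 q01 q0E q0q1 q1E /andP[t0 t1] pE qE.
have q00 : 0 < q0 by lra.
have q10 : 0 < q1 by lra.
have V : q1^-1 < q0^-1 by rewrite ltf_pV2 ?posrE.
have V0 : 0 < q1^-1 by rewrite invr_gt0.
have qVE : q^-1 = p^-1 - th by move: pE qE; nra.
have qV1 : q1^-1 <= q^-1 by nra.
have qV0 : q^-1 < q0^-1 by nra.
have qVp : 0 < q^-1 by lra.
have q_gt0 : 0 < q by rewrite -invr_gt0.
have p_gt0 : 0 < p by rewrite -invr_gt0; lra.
split => //; last by rewrite -lef_pV2 ?posrE.
- by rewrite -[p]invrK -invr1 ltf_pV2 ?posrE ?invr_gt0//; lra.
- by rewrite -ltf_pV2 ?posrE.
Qed.

Lemma weighted_normE (R : realType) n (w : euclidean R n -> R) (r : R) F :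
  weighted_norm w r F =
  ((\int[lebesgue R n]_x `|F x * (w x)%:E| `^ r) `^ r^-1)%E.
Proof. by rewrite /weighted_norm unlock. Qed.

Lemma weighted_norm_eq0 (R : realType) n (w : euclidean R n -> R) (r : R) F :
  0 < r -> {ae lebesgue R n, forall x, w x = 0} -> weighted_norm w r F = 0%E.
Proof.
move=> r0 w0; rewrite weighted_normE.
rewrite (@ae_eq_ge0_integral _ _ _ _ _ _ (fun=> 0%E)) ?integral0//.
- by rewrite poweR_EFin powR0// invr_eq0 gt_eqF.
- by move=> x _; exact: poweR_ge0.
- apply: filterS w0 => x -> _.
  by rewrite mule0 abse0 poweR_EFin powR0// gt_eqF.
Qed.

(** Borel representatives of [f] and [w] leave the norms and the maximal function unchanged, so that
    [strong_type] applies. *)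
Lemma fractional_maximal_A1 (R : realType) n (alpha p q C : R)
    (w v : euclidean R n -> R) :
  0 < alpha / n%:R < 1 -> 1 < p -> 0 < q -> q^-1 = p^-1 - alpha / n%:R ->
  1 <= C -> measurable_fun setT v -> (forall x, 0 < v x) ->
  {ae lebesgue R n, forall x, w x = v x} -> A1_cells C (fun x => v x `^ q) ->
  exists2 D : R, 0 < D & forall f, weighted_L w p f ->
    (weighted_norm w q (fractional_maximal alpha f) <=
     D%:E * weighted_norm w p (EFin \o f))%E.
Proof.
set th := alpha / n%:R => th01 p1 q0 pq C1 mv v0 wv vA1.
have p0 : 0 < p by lra.
(* The constant of [strong_type] without its powers of [b], the p-th power of the norm of [f]. *)
pose K := ((6 ^+ n) `^ (1 - th)) `^ q * C `^ ((1 - th) * q) *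
  (#|{ffun 'I_n -> bool}|%:R * (2 `^ p / (p - 1))).
have K0 : 0 < K.
  apply: mulr_gt0.
    by rewrite mulr_gt0// powR_gt0 ?powR_gt0 ?exprn_gt0//; lra.
  apply: mulr_gt0; first by rewrite ltr0n; apply/card_gt0P; exists [ffun=>
    true].
  by rewrite divr_gt0 ?powR_gt0//; lra.
exists (K `^ q^-1); first exact: powR_gt0.
move=> f [[g mg fg] f_lty].
have normE : (weighted_norm w p (EFin \o f) =
    (\int[lebesgue R n]_x ((`|g x| * v x) `^ p)%:E) `^ p^-1)%E.
  rewrite weighted_normE; apply: (congr1 (poweR ^~ p^-1)).
  apply: ae_eq_ge0_integral.
  - by move=> x _; exact: poweR_ge0.
  - by move=> x _; rewrite lee_fin powR_ge0.
  - apply: (filterS2 _ _ fg wv) => x fgx wvx _ /=.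
    by rewrite fgx wvx normrM (gtr0_norm (v0 x)).
have gp_lty : (\int[lebesgue R n]_x ((`|g x| * v x) `^ p)%:E < +oo)%E.
  apply: (@lty_poweRy _ _ p^-1); first by rewrite invr_eq0 gt_eqF.
  by rewrite -normE.
have := strong_type th01 p1 q0 C1 pq mv v0 vA1 mg gp_lty (erefl th).
rewrite normE weighted_normE (ae_eq_fractional_maximal alpha fg).
rewrite (@ae_eq_ge0_integral _ _ _ _ _ (fun x => `|_|%E `^ q)%E
  (fun x => (fractional_maximal alpha g x * (v x)%:E) `^ q)%E); last 3 first.
- by move=> x _; exact: poweR_ge0.
- by move=> x _; exact: poweR_ge0.
- apply: (filterS _ wv) => x -> _; rewrite gee0_abs//.
  by apply: mule_ge0; [exact: fractional_maximal_ge0|rewrite lee_fin ltW].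
have : (\int[lebesgue R n]_x ((`|g x| * v x) `^ p)%:E)%E \is a fin_num.
  by rewrite ge0_fin_numE//; apply: integral_ge0 => x _;
    rewrite lee_fin powR_ge0.
have : (0 <= \int[lebesgue R n]_x ((`|g x| * v x) `^ p)%:E)%E.
  by apply: integral_ge0 => x _; rewrite lee_fin powR_ge0.
have : (0 <= \int[lebesgue R n]_x (fractional_maximal alpha g x * (v x)%:E) `^
  q)%E.
  by apply: integral_ge0 => x _; exact: poweR_ge0.
move: (integral _ _ _) (integral _ _ _) => J I; case: J => [b||]// I0 b0 _ Ib.
rewrite lee_fin in b0; rewrite poweR_EFin -EFinM.
(* The powers of [b] combine to [b^(q/p)], whose q-th root is the norm of [f]. *)
have qth : q * th + 1 = q / p.
  have e : th = p^-1 - q^-1 by move: pq; lra.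
  by rewrite e; field; rewrite !gt_eqF.
have -> : K `^ q^-1 * b `^ p^-1 = (K * (b `^ (q * th) * b)) `^ q^-1.
  have -> : b `^ (q * th) * b = b `^ (q / p).
    rewrite -[X in _ * X](powRr1 b0) -powRD; last first.
      by apply/implyP => /eqP H; move: qth; rewrite H => /esym/eqP;
        rewrite gt_eqF// divr_gt0.
    by rewrite qth.
  by rewrite powRM ?powR_ge0 ?(ltW K0)// -powRrM mulrAC divff ?mul1r// gt_eqF.
rewrite -poweR_EFin; apply: gt0_ler_poweR; rewrite ?in_itv/= ?leey ?andbT//.
- by rewrite invr_ge0 ltW.
- rewrite lee_fin; apply: mulr_ge0; first exact: ltW.
  by rewrite mulr_ge0// powR_ge0.
- apply: (le_trans Ib); rewrite lee_fin le_eqVlt; apply/orP; left; apply/eqP.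
  rewrite /K /=; lra.
Qed.

Theorem corollary4p2 (R : realType) (n : nat) (alpha q0 : R)
    (w : euclidean R n -> R)
    (halpha : 0 < alpha < n%:R)
    (hq0 : 1 < q0)
    (hq0E : 1 / q0 = 1 - alpha / n%:R)
    (hw0 : forall x, 0 <= w x)
    (hwloc : locally_integrable_tuple w)
    (hwA : muckenhoupt_A1 q0 w) :
  exists q1 p1 : R,
    [/\ q0 < q1, 1 < p1 < n%:R / alpha, 1 / q1 = 1 / p1 - alpha / n%:R &
      forall t p q : R, 0 <= t < 1 ->
        1 / p = t + (1 - t) / p1 ->
        1 / q = t / q0 + (1 - t) / q1 ->
        exists2 C : R, 0 < C &
          forall f : euclidean R n -> R, weighted_L w p f ->
            (weighted_norm w q (fractional_maximal alpha f)
               <= C%:E * weighted_norm w p (EFin \o f))%E].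
Proof.
have [a0 an] := andP halpha; have n0 : 0 < n%:R :> R by exact: lt_trans an.
have th0 : 0 < alpha / n%:R by rewrite divr_gt0.
have th1 : alpha / n%:R < 1 by rewrite ltr_pdivrMr// mul1r.
have q00 : 0 < q0 by lra.
(* The equation defines [p1], and [1/p1] lies strictly between [alpha/n] and
   [1/q0 + alpha/n = 1]. *)
have exponents (e0 : R) : 0 < e0 -> exists p1, [/\ q0 < q0 * (1 + e0),
    1 < p1 < n%:R / alpha & 1 / (q0 * (1 + e0)) = 1 / p1 - alpha / n%:R].
  move=> e00; have qq : q0 < q0 * (1 + e0) by rewrite ltr_pMr//; lra.
  have V0 : 0 < (q0 * (1 + e0))^-1 by rewrite invr_gt0 mulr_gt0//; lra.
  have V : (q0 * (1 + e0))^-1 < q0^-1.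
    by rewrite ltf_pV2 ?posrE// mulr_gt0//; lra.
  exists ((q0 * (1 + e0))^-1 + alpha / n%:R)^-1; split => //; last first.
    by rewrite !div1r invrK addrK.
  have -> : n%:R / alpha = (alpha / n%:R)^-1 by rewrite invf_div.
  have p0 : 0 < (q0 * (1 + e0))^-1 + alpha / n%:R by rewrite addr_gt0.
  apply/andP; split; last by rewrite ltf_pV2 ?posrE// ltrDr.
  by rewrite invf_gt1//; rewrite div1r in hq0E; lra.
have [w_eq0|[v [mv v0 wv [C C1 vA1]]]] :=
    muckenhoupt_A1_cells q00 hw0 (proj1 hwloc) hwA.
  (* For a weight that vanishes almost everywhere the left norm is zero, so any [e0] and [C]
     serve. *)
  have [p1 [qq1 p1lt q1E]] := exponents 1 ltr01.
  exists (q0 * (1 + 1)), p1; split => // t p q t01 pE qE; exists 1 => // f _.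
  have [_ q0q _ _] := exponent_relations th0 hq0 hq0E qq1 q1E t01 pE qE.
  rewrite weighted_norm_eq0//; last by lra.
  by rewrite mul1e weighted_normE poweR_ge0.
have n2 : 1 <= 2 ^+ n :> R by rewrite exprn_ege1//; lra.
(* [Z] is the factor of [e] in the smallness condition of [A1_cells_powR]; with [e0 = 1 / (Z + 1)]
   every [e <= e0] satisfies it and is below 1. *)
pose Z := (2 * C - 1) * 2 ^+ n; have Z1 : 1 <= Z by rewrite /Z; nra.
pose e0 := (Z + 1)^-1.
have e00 : 0 < e0 by rewrite invr_gt0; lra.
have e0Z : e0 * (Z + 1) = 1 by rewrite mulVf// gt_eqF//; lra.
have [p1 [qq1 p1lt q1E]] := exponents e0 e00.
exists (q0 * (1 + e0)), p1; split => // t p q t01 pE qE.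
have [p_gt1 q0q qq1' pq] := exponent_relations th0 hq0 hq0E qq1 q1E t01 pE qE.
(* With this [e] the weight [v^q] is [(v^q0)^(1+e)], and [q <= q1] means [e <= e0]. *)
pose e := q / q0 - 1.
have qe : q = q0 * (1 + e) by rewrite /e; field; rewrite gt_eqF.
have e_gt0 : 0 < e by rewrite /e subr_gt0 ltr_pdivlMr// mul1r.
have e_le : e <= e0 by move: qq1'; rewrite qe ler_pM2l// lerD2l.
have e01 : 0 < e < 1 by rewrite e_gt0; nra.
have eC : e * (2 * C - 1) * 2 ^+ n <= 1 by rewrite -mulrA -/Z; nra.
have vq0 x : 0 < v x `^ q0 by exact: powR_gt0.
have := A1_cells_powR C1 (measurable_fun_powR q0 mv) vq0 vA1 e01 eC.
have -> : (fun x => (v x `^ q0) `^ (1 + e)) = (fun x => v x `^ q).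
  by apply/funext => x; rewrite qe powRrM.
have C'1 : 1 <= 2 * C * C `^ (1 + e).
  have : 1 `^ (1 + e) <= C `^ (1 + e).
    by apply: ge0_ler_powR; rewrite ?nnegrE//; lra.
  rewrite powR1; nra.
apply: (fractional_maximal_A1 _ p_gt1 _ pq C'1 mv v0 wv); last by lra.
by rewrite th0.
Qed.
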